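(* For every integer $n\ge0$, every $i\in\{0,2\}$ and every $k\in\{0,1,2,3,4\}$, the number of partitions $\pi$ of $5n+4$ with $\mathrm{srank}(\pi)\equiv i\pmod 4$ and $\mathrm{St\text{-}crank}(\pi)\equiv k\pmod 5$ equals $\tfrac15 p_i(5n+4)$. In other words, the residue of the St-crank mod $5$ divides the partitions enumerated by $p_i(5n+4)$ into five equinumerous classes.
   Context: Partitions are written $\pi=(\lambda_1\ge\lambda_2\ge\cdots)$; $|\pi|$ is the sum of parts, $\pi'$ the conjugate, $f_k$ the number of parts equal to $k$. $\mathcal O(\pi)$ is the number of odd parts, $\mathrm{srank}(\pi)=\mathcal O(\pi)-\mathcal O(\pi')$ (always even), and $p_i(n)$ ($i=0,2$) is the number of partitions of $n$ with $\mathrm{srank}\equiv i\pmod 4$. Andrews–Garvan crank: with $\ell(\pi)$ the largest part ($0$ if empty), $\mu(\pi)$ the number of parts equal to $1$, $\tilde\nu(\pi)$ the number of parts larger than $\mu(\pi)$: $\mathrm{crank}(\pi)=\ell(\pi)$ if $\mu(\pi)=0$, and $\tilde\nu(\pi)-\mu(\pi)$ otherwise. For a partition $\pi$ let $\pi_1$ be the partition in which each $k\ge1$ occurs $\lfloor f_{2k}(\pi)/2\rfloor$ times. Type B: $\pi=(\lambda_1,\lambda_2,\dots)$ with conjugate $(\lambda_1',\lambda_2',\dots)$ is of type B iff either $\pi=(3,1)$, or: $|\pi|\ne4$, $\lambda_1-\lambda_2\ge2$, $\lambda_1'-\lambda_2'\ge2$, it is not the case that $\lambda_1-2$ and $\lambda_2$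 are equal even integers, and $\pi$ has no repeated even parts. $\Psi(\pi)=1$ if $\pi$ is of type B, else $0$. $\mathrm{St\text{-}crank}(\pi)=\mathrm{crank}(\pi_1)+\tfrac12\mathrm{srank}(\pi)+\Psi(\pi)$. *)

(* Defs.v *)
(* Partitions are represented as nonincreasing lists of
   positive naturals (largest part first). *)
From mathcomp Require Import all_boot all_order all_algebra.
Set Implicit Arguments. Unset Strict Implicit. Unset Printing Implicit Defensive.
Import GRing.Theory Num.Theory.

Definition psize (s : seq nat) : nat := sumn s.

Definition lam (s : seq nat) (i : nat) : nat := nth 0 s i.-1.

Definition conj (s : seq nat) : seq nat :=
  [seq count (fun x => j <= x) s | j <- iota 1 (head 0 s)].

Definition mult (s : seq nat) (k : nat) : nat := count_mem k s.

Definition nodd (s : seq nat) : nat := count odd s.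

Definition srank (s : seq nat) : int := ((Posz (nodd s)) - Posz (nodd (conj s)))%R.

Definition largest (s : seq nat) : nat := head 0 s.
Definition mu (s : seq nat) : nat := count (pred1 1) s.
Definition nutilde (s : seq nat) : nat := count (fun x => mu s < x) s.
Definition crank (s : seq nat) : int :=
  if mu s == 0 then (Posz (largest s)) else ((Posz (nutilde s)) - (Posz (mu s)))%R.

Definition pi1 (s : seq nat) : seq nat :=
  flatten [seq nseq (mult s (2 * k))./2 k | k <- rev (iota 1 (largest s))].

Definition typeB (s : seq nat) : bool :=
  (s == [:: 3; 1]) ||
  [&& psize s != 4,
      lam s 2 + 2 <= lam s 1,
      lam (conj s) 2 + 2 <= lam (conj s) 1,
      ~~ ((((Posz (lam s 1)) - 2)%R == (Posz (lam s 2))) && ~~ odd (lam s 2)) &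
      all (fun k => odd k || (mult s k <= 1)) s].

Definition Psi (s : seq nat) : int := if typeB s then 1 else 0.

Definition stcrank (s : seq nat) : int :=
  (crank (pi1 s) + (srank s %/ 2)%Z + Psi s)%R.

(* Partitions of N are encoded as nonincreasing N-tuples of numbers in [0, N]
   summing to N (zero padding); [ptn t] is the partition itself. *)
Definition ptn (N : nat) (t : N.-tuple 'I_N.+1) : seq nat :=
  [seq x <- map val t | 0 < x].

Definition is_ptuple (N : nat) (t : N.-tuple 'I_N.+1) : bool :=
  sorted geq (map val t) && (sumn (map val t) == N).

Definition npart (N : nat) (P : seq nat -> bool) : nat :=
  #|[set t : N.-tuple 'I_N.+1 | is_ptuple t && P (ptn t)]|.

Definition p_i (i : int) (N : nat) : nat :=
  npart N (fun s => (srank s %% 4)%Z == i).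

(* Main.v *)
Require Import Defs.
From mathcomp Require Import all_boot all_order all_algebra all_field.
From mathcomp Require Import ring zify.
Set Implicit Arguments. Unset Strict Implicit. Unset Printing Implicit Defensive.
Import GRing.Theory Num.Theory.

(** Work in a commutative ring where q is nilpotent, so that q-series are finite; Q = q^4.
    Splitting pairs of equal even parts off a partition changes |pi| by 4 |pi_1| and leaves
    the srank alone, so that without Psi the generating function factors as C(x, Q) E(u, q),
    with C the crank generating function, E that of the srank over partitions without
    repeated even parts, and u = x y. Partitions of type B are exactly the (a + 2, r, 1, 1)
    for (a, r) without repeated even parts, together with (3, 1), so Psi adds (x - 1) Q E:
    this is just what turns C into the product (Q)/((xQ)(Q/x)). Hence, for y^2 = 1 and
    p = y q^2, the total is (Q)(-q; q^2)/((xp; p)(p/x; p)). For x a primitive fifth root of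
    unity, multiplying by (p; p)(x^2; p)(p/x^2; p) makes the denominator (p^5; p^5) and the
    numerator a product of two theta series, with exponents 2 k^2 - k + r^2 - r; such an
    exponent is 4 mod 5 only if 2 r = 1 mod 5, and then the terms r and 1 - r cancel.
    So the coefficient of q^(5 n + 4) vanishes, and Fourier inversion over the fifth roots
    of unity and y = 1, -1 concludes. *)

(** * q-series with nilpotent q *)

Section QSeries.
Local Open Scope ring_scope.
Variable A : comUnitRingType.
Implicit Types (a c v w x y z Q : A) (f g : nat -> nat -> A).

Lemma unit_1B_nilp a M : a ^+ M = 0 -> 1 - a \is a GRing.unit.
Proof.
move=> aM; have := subrX1 a M; rewrite aM sub0r => /eqP.
rewrite -opprB mulNr eqr_opp => /eqP h.
by apply/unitrPr; exists (\sum_(i < M) a ^+ i).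
Qed.

Lemma exprM_nilp a b M : a ^+ M = 0 -> (a * b) ^+ M = 0.
Proof. by move=> aM; rewrite exprMn aM mul0r. Qed.

Lemma expr_nilp_ge a M n : a ^+ M = 0 -> (M <= n)%N -> a ^+ n = 0.
Proof. by move=> aM /subnK <-; rewrite exprD aM mulr0. Qed.

Definition qpoch a Q n : A := \prod_(i < n) (1 - a * Q ^+ i).

Lemma qpochS a Q n : qpoch a Q n.+1 = qpoch a Q n * (1 - a * Q ^+ n).
Proof. by rewrite /qpoch big_ord_recr. Qed.

Lemma qpoch0 a Q : qpoch a Q 0 = 1.
Proof. by rewrite /qpoch big_ord0. Qed.

Lemma qpochSl a Q n : qpoch a Q n.+1 = (1 - a) * qpoch (a * Q) Q n.
Proof.
rewrite /qpoch big_ord_recl expr0 mulr1; congr (_ * _).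
by apply: eq_bigr => i _; rewrite exprS mulrA.
Qed.

Lemma qpochD a Q m n : qpoch a Q (m + n) = qpoch a Q m * qpoch (a * Q ^+ m) Q n.
Proof.
elim: n => [|n IH]; first by rewrite addn0 qpoch0 mulr1.
by rewrite addnS !qpochS IH -!mulrA -exprD.
Qed.

(** The factors from index [M] on are 1, so [qpoch a Q M] is the infinite product (a; Q). *)
Lemma qpoch_stable a Q M n : Q ^+ M = 0 -> (M <= n)%N -> qpoch a Q n = qpoch a Q M.
Proof.
move=> QM /subnKC <-; rewrite qpochD QM mulr0 /qpoch.
rewrite [X in _ * X]big1 ?mulr1 // => i _.
by rewrite mul0r subr0.
Qed.

Lemma qpoch_unit a Q M n : a ^+ M = 0 -> qpoch a Q n \is a GRing.unit.
Proof.
move=> aM; apply: rpred_prod => i _.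
by apply: (@unit_1B_nilp _ M); apply: exprM_nilp.
Qed.

(* [gauss_sum Q N f] is the sum of [N, j]_Q * f j l over j + l = N, where [N, j]_Q is
   the Gaussian binomial; the recursion is one q-Pascal rule, [gauss_sumSr] the other. *)
Fixpoint gauss_sum Q N f : A :=
  if N is N'.+1 then gauss_sum Q N' (fun j l => f j.+1 l + Q ^+ j * f j l.+1)
  else f 0%N 0%N.

Lemma eq_gauss_sum Q N f g : (forall j l, (j + l = N)%N -> f j l = g j l) ->
  gauss_sum Q N f = gauss_sum Q N g.
Proof.
elim: N f g => [|N IH] f g fg /=; first exact: fg.
by apply: IH => j l jl; rewrite !fg ?addnS ?addSn ?jl.
Qed.

Lemma gauss_sumZD Q N a f g :
  gauss_sum Q N (fun j l => a * f j l + g j l) = a * gauss_sum Q N f + gauss_sum Q N g.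
Proof.
elim: N f g => [//|N IH] f g /=; rewrite -IH.
by apply: eq_gauss_sum => j l _; ring.
Qed.

Lemma gauss_sumZ Q N a f : gauss_sum Q N (fun j l => a * f j l) = a * gauss_sum Q N f.
Proof.
elim: N f => [//|N IH] f /=; rewrite -IH.
by apply: eq_gauss_sum => j l _; ring.
Qed.

Lemma gauss_sumSr Q N f : gauss_sum Q N.+1 f =
  gauss_sum Q N (fun j l => Q ^+ l * f j.+1 l + f j l.+1).
Proof.
elim: N f => [|N IH] f; first by rewrite /= !expr0 !mul1r.
rewrite -[LHS]/(gauss_sum Q N.+1 (fun j l => f j.+1 l + Q ^+ j * f j l.+1)) IH /=.
by apply: eq_gauss_sum => j l _; rewrite !exprS; ring.
Qed.

(** This is [N, j] = (Q)_N / ((Q)_j (Q)_(N-j)) with the denominators cleared, so that it holds for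
    every [Q]. *)
Lemma gauss_sum_qpoch Q N f :
  gauss_sum Q N (fun j l => qpoch Q Q j * qpoch Q Q l * f j l) =
  qpoch Q Q N * \sum_(j < N.+1) f j (N - j)%N.
Proof.
elim: N f => [|N IH] f.
  by rewrite /= !qpoch0 big_ord_recl big_ord0 addr0 subnn !mul1r.
rewrite /=; under eq_gauss_sum => j l jl.
  have -> : qpoch Q Q j.+1 * qpoch Q Q l * f j.+1 l +
       Q ^+ j * (qpoch Q Q j * qpoch Q Q l.+1 * f j l.+1) =
     qpoch Q Q j * qpoch Q Q l *
       ((1 - Q ^+ j.+1) * f j.+1 l + (Q ^+ j - Q ^+ (j + l).+1) * f j l.+1).
    by rewrite !qpochS !exprS exprD; ring.
  over.
rewrite (IH (fun j l => (1 - Q ^+ j.+1) * f j.+1 l +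
                        (Q ^+ j - Q ^+ (j + l).+1) * f j l.+1)).
rewrite qpochS -mulrA; congr (_ * _); rewrite big_split /= -exprS.
(* The weight 1 - Q^i vanishes at i = 0 and Q^i - Q^(N+1) at i = N + 1, so both sums can run up to N
   + 1; the two weights then add up to the new factor 1 - Q^(N+1). *)
have -> : \sum_(i < N.+1) (1 - Q ^+ i.+1) * f i.+1 (N - i)%N =
          \sum_(i < N.+2) (1 - Q ^+ i) * f i (N.+1 - i)%N.
  rewrite [RHS]big_ord_recl expr0 subrr mul0r add0r.
  by apply: eq_bigr => i _; rewrite lift0 subSS.
have -> : \sum_(i < N.+1) (Q ^+ i - Q ^+ (i + (N - i)).+1) * f i (N - i).+1 =
          \sum_(i < N.+2) (Q ^+ i - Q ^+ N.+1) * f i (N.+1 - i)%N.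
  rewrite [RHS]big_ord_recr /= subrr mul0r addr0.
  apply: eq_bigr => i _; have iN : (i <= N)%N by rewrite -ltnS.
  by rewrite subnKC // subSn.
rewrite -big_split mulr_sumr; apply: eq_bigr => i _ /=; ring.
Qed.

Lemma gauss_sumE Q N f M : Q ^+ M = 0 ->
  gauss_sum Q N f =
  qpoch Q Q N * \sum_(j < N.+1) f j (N - j)%N / (qpoch Q Q j * qpoch Q Q (N - j)).
Proof.
move=> QM; rewrite -(gauss_sum_qpoch Q N (fun j l => f j l / (qpoch Q Q j * qpoch Q Q l))).
apply: eq_gauss_sum => j l _.
by rewrite mulrC divrK // unitrM !(qpoch_unit _ _ QM).
Qed.

(** Only l < M contributes, and then j = 2 M - l exceeds M: there [a] is constant and the Gaussian
    binomial has reached its limit 1 / (Q)_l. *)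
Lemma gauss_sum_lim Q M (a b : nat -> A) : Q ^+ M = 0 ->
  (forall j, (M <= j)%N -> a j = a M) -> (forall l, (M <= l)%N -> b l = 0) ->
  gauss_sum Q (M + M) (fun j l => a j * b l) = a M * \sum_(l < M) b l / qpoch Q Q l.
Proof.
move=> QM ha hb; rewrite (gauss_sumE _ _ QM).
rewrite (reindex_inj rev_ord_inj) /= mulr_sumr mulr_sumr.
have le : (M <= (M + M).+1)%N by lia.
rewrite (big_ord_widen _ (fun l => a M * (b l / qpoch Q Q l)) le) /= [in RHS]big_mkcond /=.
apply: eq_bigr => i _; have iM := ltn_ord i; rewrite subSS subKn //.
case: ltnP => hi; last by rewrite hb // mulr0 mul0r mulr0.
have h : (M <= M + M - i)%N by lia.
rewrite ha // (qpoch_stable Q QM h) (qpoch_stable Q QM (leq_addr M M)) invrM ?(qpoch_unit _ _ QM) //.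
have u := qpoch_unit Q M QM.
rewrite [_^-1 * _]mulrC [X in _ = X](_ : _ = (qpoch Q Q M / qpoch Q Q M) * (a M * (b i / qpoch Q Q i))).
  by ring.
by rewrite divrr // mul1r.
Qed.

(** The q-binomial series 1phi0 in homogeneous form: the product is v^l (-c/v; Q)_l, and c = 0 gives
    Euler's series. *)
Definition qbin_series v c Q M z : A :=
  \sum_(l < M) (\prod_(i < l) (v + c * Q ^+ i)) * z ^+ l / qpoch Q Q l.

(** The coefficients t_l satisfy t_(l+1) (1 - Q^(l+1)) = (v + c Q^l) t_l, which sums to F(z) - F(Qz)
    = v z F(z) + c z F(Qz). *)
Lemma qbin_series_shift v c Q M z : Q ^+ M = 0 -> z ^+ M = 0 ->
  (1 - v * z) * qbin_series v c Q M z = (1 + c * z) * qbin_series v c Q M (Q * z).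
Proof.
move=> QM zM; rewrite /qbin_series.
pose t l := (\prod_(i < l) (v + c * Q ^+ i)) / qpoch Q Q l.
have tE l : t l.+1 * (1 - Q ^+ l.+1) = (v + c * Q ^+ l) * t l.
  rewrite /t big_ord_recr /= qpochS -exprS invrM ?(qpoch_unit _ _ QM) //; last first.
    by apply: (@unit_1B_nilp _ M); rewrite exprS; apply: exprM_nilp.
  rewrite [(1 - _)^-1 * _]mulrC !mulrA divrK; first by ring.
  by apply: (@unit_1B_nilp _ M); rewrite exprS; apply: exprM_nilp.
have tS w : \sum_(l < M) (\prod_(i < l) (v + c * Q ^+ i)) * w ^+ l / qpoch Q Q l
   = \sum_(l < M) t l * w ^+ l.
  by apply: eq_bigr => l _; rewrite /t mulrAC.
rewrite !tS; suff h : \sum_(l < M) t l * z ^+ l - \sum_(l < M) t l * (Q * z) ^+ l =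
   v * z * (\sum_(l < M) t l * z ^+ l) + c * z * (\sum_(l < M) t l * (Q * z) ^+ l).
  move: h; set F := \sum_(l < M) _; set G := \sum_(l < M) _ => h.
  rewrite (_ : (1 - v * z) * F = F - G - v * z * F + G); last by ring.
  by rewrite h; ring.
have zM1 : \sum_(l < M) t l * z ^+ l - \sum_(l < M) t l * (Q * z) ^+ l =
  \sum_(l < M.+1) t l * (1 - Q ^+ l) * z ^+ l.
  rewrite big_ord_recr /= zM mulr0 addr0 -sumrB.
  by apply: eq_bigr => l _; rewrite exprMn; ring.
rewrite zM1 big_ord_recl expr0 subrr mulr0 mul0r add0r !mulr_sumr -big_split /=.
by apply: eq_bigr => l _; rewrite /bump leq0n add1n tE exprMn !exprS; ring.
Qed.

(** Iterating the shift M times moves the argument from z to Q^M z = 0, where the series is 1. *)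
Lemma qbinomial v c Q M z : Q ^+ M = 0 -> z ^+ M = 0 ->
  qbin_series v c Q M z * qpoch (v * z) Q M = qpoch (- (c * z)) Q M.
Proof.
move=> QM zM.
have step k : qbin_series v c Q M z * qpoch (v * z) Q k =
  qpoch (- (c * z)) Q k * qbin_series v c Q M (Q ^+ k * z).
  elim: k => [|k IH]; first by rewrite !qpoch0 mulr1 !mul1r.
  rewrite !qpochS mulrA IH -!mulrA; congr (_ * _).
  have nz : (Q ^+ k * z) ^+ M = 0 by rewrite mulrC; apply: exprM_nilp.
  rewrite mulrC (_ : v * (z * _) = v * (Q ^+ k * z)); last by ring.
  rewrite (qbin_series_shift v c QM nz) [Q * (_ * _)]mulrA -exprS; congr (_ * _); ring.
rewrite step QM mul0r /qbin_series.
(* For M = 0 the empty series is 0 and not 1, but [QM] then says that 1 = 0. *)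
case: M QM zM {step} => [|M] QM zM.
  by rewrite expr0 in QM; rewrite big_ord0 mulr0 -[RHS]mul1r QM mul0r.
rewrite big_ord_recl [X in _ + X]big1 => [|i _]; last by rewrite lift0 exprS mul0r mulr0 mul0r.
by rewrite big_ord0 expr0 qpoch0 divr1 addr0 !mulr1.
Qed.

(* r (r - 1) / 2 for an integer r *)
Definition tri (r : int) : nat :=
  match r with Posz n => 'C(n, 2) | Negz n => 'C(n.+2, 2) end.

(** The increment of [tri] at r is r; writing r = a - l keeps the identity in [nat] for negative
    r. *)
Lemma triS (r : int) (a l : nat) : a%:Z = r + l%:Z -> (tri (r + 1) + l = tri r + a)%N.
Proof.
case: r => [n|n] h.
  have -> : Posz n + 1 = n.+1%:Z by lia.
  by rewrite /= binS bin1; lia.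
case: n h => [|n] h; first by rewrite (_ : tri (_ + 1) = 0)%N // (_ : tri (Negz 0) = 1)%N //; lia.
have -> : Negz n.+1 + 1 = Negz n by lia.
by rewrite /= [in RHS]binS bin1; lia.
Qed.

Lemma tri_ge (r : int) : (`|r|%N <= (tri r).+1)%N.
Proof.
case: r => [n|n] /=.
  by case: n => // n; rewrite binS bin1; lia.
by rewrite binS bin1; lia.
Qed.

(* The general term of Ramanujan's f(a, b); with a = y and b = Q / y it is y^r Q^(r (r - 1) / 2). *)
Definition theta_term a b (r : int) : A := a ^+ tri (r + 1) * b ^+ tri r.

(** Consecutive terms have ratio a (ab)^r; the exponents k and l with r = k - l clear the negative
    powers, as ab need not be invertible. *)
Lemma theta_termS a b (r : int) (k l : nat) : k%:Z = r + l%:Z ->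
  (a * b) ^+ l * theta_term a b (r + 1) = a * (a * b) ^+ k * theta_term a b r.
Proof.
move=> h; have h' : k.+1%:Z = (r + 1) + l%:Z by lia.
have := congr1 (fun n => a ^+ n) (triS h'); have := congr1 (fun n => b ^+ n) (triS h).
rewrite /theta_term !exprD exprS !exprMn => e1 e2.
rewrite [LHS](_ : _ = (a ^+ tri (r + 1 + 1) * a ^+ l) * (b ^+ tri (r + 1) * b ^+ l)); last by ring.
by rewrite e1 e2; ring.
Qed.

Lemma theta_termP a b (r : int) (k l : nat) : k%:Z = r + l%:Z ->
  (a * b) ^+ k * theta_term a b (r - 1) = b * (a * b) ^+ l * theta_term a b r.
Proof.
move=> h; have h' : k%:Z = (r - 1) + l.+1%:Z by lia.
have := congr1 (fun n => a ^+ n) (triS h); have := congr1 (fun n => b ^+ n) (triS h').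
rewrite /theta_term subrK !exprD exprS !exprMn => e1 e2.
rewrite [LHS](_ : _ = (a ^+ tri r * a ^+ k) * (b ^+ tri (r - 1) * b ^+ k)); last by ring.
by rewrite -e1 -e2; ring.
Qed.

(** Cauchy's finite form of the triple product: one q-Pascal rule absorbs a new factor of the
    b-product, the other a new factor of the a-product, because neighbouring theta terms differ by a
    monomial. *)
Lemma finite_jacobi a b (m n : nat) :
  qpoch (- a) (a * b) m * qpoch (- b) (a * b) n =
  gauss_sum (a * b) (m + n) (fun j l => theta_term a b (j%:Z - n%:Z)).
Proof.
elim: n => [|n IH]; last first.
  rewrite qpochS mulrA {}IH addnS /= mulrC -gauss_sumZ.
  apply: eq_gauss_sum => j l jl.
  have -> : j.+1%:Z - n.+1%:Z = j%:Z - n%:Z by lia.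
  have -> : j%:Z - n.+1%:Z = j%:Z - n%:Z - 1 by lia.
  by rewrite (@theta_termP a b _ j n) ?subrK //; ring.
elim: m => [|m IH].
  by rewrite !qpoch0 /= /theta_term subrr /= !expr0.
rewrite qpoch0 mulr1 in IH; rewrite qpochS qpoch0 mulr1 IH !addn0 gauss_sumSr.
rewrite mulrC -gauss_sumZ; apply: eq_gauss_sum => j l jl.
have -> : j.+1%:Z - 0%:Z = (j%:Z - 0%:Z) + 1 by lia.
rewrite (@theta_termS _ _ _ m) //; first by ring.
by lia.
Qed.

Lemma theta_term_nilp a b M (r : int) : (a * b) ^+ M = 0 -> (M.+1 < `|r|)%N ->
  theta_term a b r = 0.
Proof.
move=> QM rM; have h1 : (M <= tri (r + 1))%N by have := tri_ge (r + 1); lia.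
have h2 : (M <= tri r)%N by have := tri_ge r; lia.
rewrite /theta_term -(subnK h1) -(subnK h2) !exprD mulrACA -exprMn QM mulr0 //.
Qed.

Lemma jacobi_triple a b M m : (a * b) ^+ M = 0 -> (M + M < m)%N ->
  qpoch (a * b) (a * b) M * qpoch (- a) (a * b) M * qpoch (- b) (a * b) M =
  \sum_(j < (m + m).+1) theta_term a b (j%:Z - m%:Z).
Proof.
move=> QM Mm; set Q := a * b in QM *; rewrite -mulrA.
rewrite -(qpoch_stable (- a) QM (_ : M <= m)%N); last by lia.
rewrite -(qpoch_stable (- b) QM (_ : M <= m)%N); last by lia.
rewrite finite_jacobi // (gauss_sumE _ _ QM) (qpoch_stable _ QM); last by lia.
rewrite !mulr_sumr; apply: eq_bigr => j _; have jm := ltn_ord j.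
(* Far terms vanish. Near the centre both j and 2 m - j are at least M, so all q-factorials take
   their stable value and cancel. *)
have [far|near] := ltnP M.+1 (`|j%:Z - m%:Z|)%N.
  by rewrite (theta_term_nilp QM far) !(mulr0, mul0r).
have u := qpoch_unit Q M QM.
rewrite !(qpoch_stable _ QM) ?invrM //; [|by lia|by lia].
set u0 := qpoch Q Q M in u *; set t := theta_term _ _ _.
rewrite (_ : u0 * _ = (u0 / u0) * (u0 / u0) * t); first by rewrite divrr // !mul1r.
by ring.
Qed.

End QSeries.

(** * Enumeration of partitions *)

Section PartitionLists.
Implicit Types (s t ks : seq nat) (b : nat -> nat).

(* All partitions with parts in the decreasing list ks, each k occurring less than b k times. *)
Fixpoint plist b ks : seq (seq nat) :=
  if ks is k :: ks' then [seq nseq m k ++ s | m <- iota 0 (b k), s <- plist b ks']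
  else [:: [::]].

Lemma mem_plist b ks s : sorted gtn ks ->
  (s \in plist b ks) =
  [&& sorted geq s, all (mem ks) s & all (fun k => count_mem k s < b k) ks].
Proof.
elim: ks s => [|k ks IH] s.
  by case: s => [|a s] //= _; rewrite !andbF.
move=> kks; have sks : sorted gtn ks by apply: path_sorted kks.
have ltk : all (fun i => i < k) ks by move: kks => /=; rewrite (path_sortedE (rev_trans ltn_trans)) => /andP[].
have knks : k \notin ks by apply/negP => /(allP ltk); rewrite ltnn.
apply/idP/idP.
  case/allpairsPdep => m [r] []; rewrite mem_iota add0n /= => mb; rewrite IH // => /and3P[sr ar cr] ->.
  have kr : k \notin r by apply/negP => /(allP ar) /=; rewrite (negPf knks).
  apply/and3P; split.
  - elim: m {mb} => //= m IHm; rewrite (path_sortedE (rev_trans leq_trans)) IHm andbT all_cat.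
    rewrite all_nseq /= leqnn orbT /=; apply/allP => y /(allP ar) /(allP ltk) /ltnW; exact.
  - apply/allP => y; rewrite mem_cat mem_nseq.
    by case/orP=> [/andP[_ /eqP ->]|/(allP ar) /= yks] /=; rewrite inE ?eqxx ?yks ?orbT.
  - rewrite /= count_cat count_nseq /= eqxx mul1n (count_memPn kr) addn0 mb /=.
    apply/allP => j jks; rewrite count_cat count_nseq /=.
    have -> : (k == j) = false by apply/negbTE; apply: contraNneq knks => ->.
    by rewrite mul0n add0n; apply: (allP cr).
case/and3P => ss /= sa /andP[ck cks].
apply/allpairsPdep; exists (count_mem k s), [seq x <- s | x != k]; split.
- by rewrite mem_iota.
- rewrite IH //; apply/and3P; split.
  + by apply: sorted_filter ss; apply: rev_trans; apply: leq_trans.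
  + apply/allP => y; rewrite mem_filter => /andP[yk /(allP sa)]; rewrite /= inE (negPf yk); exact.
  + apply/allP => j jks; rewrite count_filter.
    rewrite (@eq_count _ _ (pred1 j)); first exact: (allP cks).
    move=> z /=; case: eqP => // ->; rewrite andTb.
    by apply/eqP => jk; move: knks; rewrite -jk jks.
elim: s ss sa {ck cks} => //= a s IHs pas; rewrite inE => /andP[ak sa].
have ss := path_sorted pas; rewrite {1}IHs //.
case: (a =P k) => [->|/eqP nak] //=.
have -> : count_mem k s = 0%N; last by [].
apply/count_memPn/negP => ks'; move: pas; rewrite (path_sortedE (rev_trans leq_trans)).
case/andP=> /allP/(_ _ ks') /= ka _; move: ak; rewrite (negPf nak) /= => /(allP ltk).
by rewrite ltnNge ka.
Qed.

Lemma plist_uniq b ks : sorted gtn ks -> uniq (plist b ks).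
Proof.
elim: ks => [//|k ks IH] kks; have sks : sorted gtn ks by apply: path_sorted kks.
have ltk : all (fun i => i < k) ks by move: kks => /=; rewrite (path_sortedE (rev_trans ltn_trans)) => /andP[].
apply: allpairs_uniq; [exact: iota_uniq|exact: IH|].
have kn r : r \in plist b ks -> count_mem k r = 0%N.
  rewrite mem_plist // => /and3P[_ ar _]; apply/count_memPn/negP => /(allP ar) /(allP ltk).
  by rewrite ltnn.
move=> [m r] [n t] /allpairsP[[m1 r1] /= [_ r1p [-> ->]]] /allpairsP[[n1 t1] /= [_ t1p [-> ->]]] e.
have := congr1 (count_mem k) e; rewrite !count_cat !count_nseq /= eqxx !mul1n !kn // !addn0 => mn.
move: e; rewrite mn => /eqP; rewrite eqseq_cat // => /andP[_ /eqP ->] //.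
Qed.

Definition parts_upto n := rev (iota 1 n).

Lemma parts_uptoS n : parts_upto n.+1 = n.+1 :: parts_upto n.
Proof. by rewrite /parts_upto -{1}[n.+1]addn1 iotaD rev_cat /= add1n. Qed.

Lemma mem_parts_upto n k : (k \in parts_upto n) = (0 < k <= n).
Proof. by rewrite mem_rev mem_iota add1n ltnS. Qed.

Lemma parts_upto_sorted n : sorted gtn (parts_upto n).
Proof. by rewrite rev_sorted; apply: iota_ltn_sorted. Qed.

Lemma leq_mem_sumn s k : k \in s -> k <= sumn s.
Proof.
elim: s => //= a s IH; rewrite inE => /orP[/eqP ->|/IH]; first exact: leq_addr.
by move=> h; apply: leq_trans h (leq_addl _ _).
Qed.

Lemma size_leq_sumn s : 0 \notin s -> size s <= sumn s.
Proof.
elim: s => //= a s IH; rewrite inE negb_or => /andP[a0 /IH h].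
by rewrite -add1n leq_add // lt0n eq_sym.
Qed.

Lemma mem_plist_upto b K s : (forall k, psize s < b k) -> psize s <= K ->
  (s \in plist b (parts_upto K)) = sorted geq s && (0 \notin s).
Proof.
move=> hb hK; rewrite mem_plist ?parts_upto_sorted //; congr (_ && _).
apply/andP/idP => [[/allP h _]|s0].
  by apply/negP => /h /=; rewrite mem_parts_upto.
split; apply/allP => k ks /=.
  rewrite mem_parts_upto lt0n; apply/andP; split; first by apply: contraNneq s0 => <-.
  by apply: leq_trans hK; apply: leq_mem_sumn.
by apply: leq_ltn_trans (hb k); apply: leq_trans (count_size _ _) (size_leq_sumn s0).
Qed.

(** A tuple is recovered from its positive entries, since the zeros stand at the end and the length
    fixes their number; this makes [ptn] injective. *)
Lemma sorted_geq_pos_cat s : sorted geq s ->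
  s = [seq x <- s | 0 < x] ++ nseq (size s - size [seq x <- s | 0 < x]) 0.
Proof.
elim: s => //= a s IH pas; have ss := path_sorted pas.
case: a pas => [|a] pas /=; last by rewrite subSS {1}IH.
have s0 : s = nseq (size s) 0.
  apply/all_pred1P; move: pas; rewrite (path_sortedE (rev_trans leq_trans)) => /andP[h _].
  by apply: sub_all h => x /=; rewrite leqn0 => /eqP ->.
have f0 : [seq x <- s | 0 < x] = [::].
  by rewrite s0; elim: (size s).
by rewrite f0 /= {1}s0.
Qed.

Lemma ptn_inj N : {in [pred t : N.-tuple 'I_N.+1 | is_ptuple t] &, injective (@ptn N)}.
Proof.
move=> t u /andP[st _] /andP[su _] e; apply/val_inj/(inj_map val_inj).
rewrite (sorted_geq_pos_cat st) (sorted_geq_pos_cat su).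
by rewrite -!/(ptn _) e !size_map !size_tuple.
Qed.

Lemma ptn_surj N s : sorted geq s -> 0 \notin s -> psize s = N ->
  exists2 t : N.-tuple 'I_N.+1, is_ptuple t & s = ptn t.
Proof.
move=> ss s0 sN.
have szs : size s <= N by rewrite -sN; apply: size_leq_sumn.
pose t : N.-tuple 'I_N.+1 := [tuple inord (nth 0 s i) | i < N].
have tE : map val t = s ++ nseq (N - size s) 0.
  apply: (@eq_from_nth _ 0); first by rewrite size_map size_tuple size_cat size_nseq subnKC.
  move=> i; rewrite size_map size_tuple => iN.
  rewrite (nth_map ord0) ?size_tuple // -[in LHS]/(nat_of_ord (Ordinal iN)) -tnth_nth tnth_mktuple /=.
  rewrite inordK; last first.
    rewrite ltnS; have [h|h] := leqP (size s) i; first by rewrite nth_default.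
    by rewrite -sN; apply: leq_mem_sumn; apply: mem_nth.
  rewrite nth_cat nth_nseq if_same; case: ltnP => // h.
  by rewrite nth_default.
have sp : [seq x <- s | 0 < x] = s.
  by apply/all_filterP/allP => x xs; rewrite lt0n; apply: contraNneq s0 => <-.
exists t; last by rewrite /ptn tE filter_cat sp; elim: (N - size s) => [|n IH] //=; rewrite cats0.
rewrite /is_ptuple tE sumn_cat sumn_nseq mul0n addn0 -/(psize s) sN eqxx andbT.
move: (N - size s) => n; elim: (s) ss => [|a r IH] /=.
  by move=> _; case: n => // n; elim: n.
move=> par; have sr := path_sorted par; move: par.
rewrite !(path_sortedE (rev_trans leq_trans)) IH // andbT all_cat => /andP[-> _] /=.
by rewrite all_nseq leq0n orbT.
Qed.

(** The bounds exclude no partition of N; leaving [b] and [K] free lets one list serve both for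
    counting and for the generating function. *)
Lemma npartE N P b K : (forall k, N < b k) -> N <= K ->
  npart N P = count (fun s => (psize s == N) && P s) (plist b (parts_upto K)).
Proof.
move=> hb hK; rewrite /npart cardE -(size_map (@ptn N)) -size_filter.
apply/perm_size/uniq_perm.
- rewrite map_inj_in_uniq ?enum_uniq // => t u; rewrite !mem_enum !inE.
  by move=> /andP[ht _] /andP[hu _]; apply: ptn_inj.
- by apply: filter_uniq; apply: plist_uniq; apply: parts_upto_sorted.
move=> s; rewrite mem_filter; apply/mapP/idP => [[t]|].
  rewrite mem_enum inE => /andP[/andP[st /eqP sumt] Pt] ->.
  have zt : psize (ptn t) = N.
    rewrite -[RHS]sumt [in RHS](sorted_geq_pos_cat st) sumn_cat sumn_nseq mul0n addn0 //.
  rewrite zt eqxx Pt mem_plist_upto ?zt // mem_filter ltnn /= andbT.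
  by apply: sorted_filter st; apply: rev_trans; apply: leq_trans.
case/andP=> /andP[/eqP sN Ps]; rewrite mem_plist_upto ?sN // => /andP[ss s0].
have [t pt est] := ptn_surj ss s0 sN; exists t => //.
by rewrite mem_enum inE pt -est.
Qed.

Lemma sum_plist (V : nmodType) b k ks (F : seq nat -> V) :
  (\sum_(s <- plist b (k :: ks)) F s =
   \sum_(m < b k) \sum_(s <- plist b ks) F (nseq m k ++ s))%R.
Proof. 
rewrite big_allpairs_dep /=.
rewrite -[RHS](big_mkord xpredT (fun m => \sum_(s <- plist b ks) F (nseq m k ++ s))%R).
by rewrite /index_iota subn0.
 Qed.

Lemma sum_plist_nil (V : nmodType) b (F : seq nat -> V) :
  (\sum_(s <- plist b [::]) F s = F [::])%R.
Proof. by rewrite /= big_seq1. Qed.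

Lemma sum_plist_cat (V : nmodType) b ks1 ks2 (F : seq nat -> V) :
  (\sum_(s <- plist b (ks1 ++ ks2)) F s =
   \sum_(s <- plist b ks1) \sum_(t <- plist b ks2) F (s ++ t))%R.
Proof.
elim: ks1 F => [|k ks1 IH] F; first by rewrite sum_plist_nil.
rewrite cat_cons !sum_plist; apply: eq_bigr => m _; rewrite IH.
by apply: eq_bigr => s _; apply: eq_bigr => t _; rewrite catA.
Qed.

Local Open Scope ring_scope.

Lemma geometric_nilp (A : comUnitRingType) (a : A) M : a ^+ M = 0 ->
  (\sum_(m < M) a ^+ m) * (1 - a) = 1.
Proof. by move=> aM; rewrite mulrC -opprB mulNr -subrX1 aM sub0r opprK. Qed.

(** Euler's product for a multiplicative weight; nilpotency makes each geometric series finite. *)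
Lemma sum_plist_prod (A : comUnitRingType) (w : nat -> A) M ks :
  (forall k, k \in ks -> w k ^+ M = 0) ->
  (\sum_(s <- plist (fun=> M) ks) \prod_(p <- s) w p) * \prod_(k <- ks) (1 - w k) = 1.
Proof.
elim: ks => [|k ks IH] hw; first by rewrite sum_plist_nil !big_nil mulr1.
rewrite sum_plist big_cons.
have -> : \sum_(m < M) \sum_(s <- plist (fun=> M) ks) \prod_(p <- nseq m k ++ s) w p =
  (\sum_(m < M) w k ^+ m) * \sum_(s <- plist (fun=> M) ks) \prod_(p <- s) w p.
  rewrite mulr_suml; apply: eq_bigr => m _; rewrite mulr_sumr; apply: eq_bigr => s _.
  by rewrite big_cat big_nseq iter_mulr_1.
rewrite mulrACA geometric_nilp ?hw ?mem_head // mul1r IH // => j jks.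
by apply: hw; rewrite inE jks orbT.
Qed.

End PartitionLists.

(** * The crank *)

Section CrankGF.
Local Open Scope ring_scope.
Variables (A : comUnitRingType) (x Q : A).

(** Ones are kept apart because their number decides how the crank is computed. *)
Definition parts_from2 n := [seq k.+1 | k <- parts_upto n].

Lemma parts_from2S n : parts_from2 n.+1 = n.+2 :: parts_from2 n.
Proof. by rewrite /parts_from2 parts_uptoS. Qed.

Lemma parts_upto_from2 n : parts_upto n.+1 = parts_from2 n ++ [:: 1%N].
Proof. by elim: n => // n IH; rewrite parts_uptoS IH parts_from2S. Qed.

Lemma plist_from2_gt1 b n s : s \in plist b (parts_from2 n) -> all (fun k => 1 < k)%N s.
Proof.
rewrite mem_plist; last first.
  rewrite /parts_from2 sorted_map; apply: sub_sorted (parts_upto_sorted n) => i j /=.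
  by rewrite ltnS.
case/and3P=> _ sa _; apply/allP => k /(allP sa) /mapP[j].
by rewrite mem_parts_upto => /andP[j0 _] ->.
Qed.

Lemma mu_cat_ones s m : all (fun k => 1 < k)%N s -> mu (s ++ nseq m 1%N) = m.
Proof.
move=> h; rewrite /mu count_cat count_nseq /= mul1n (_ : count _ s = 0)%N //.
by apply/eqP; rewrite -leqn0 leqNgt -has_count; apply/hasPn => k /(allP h); case: k => [|[|]].
Qed.

Lemma crank_no_ones s : all (fun k => 1 < k)%N s -> crank s = head 0%N s.
Proof. by move=> /(mu_cat_ones 0); rewrite cats0 /crank => ->. Qed.

Lemma crank_cat_ones s m : all (fun k => 1 < k)%N s -> (0 < m)%N ->
  crank (s ++ nseq m 1%N) = (count (fun k => m < k)%N s)%:Z - m%:Z.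
Proof.
move=> h m0; rewrite /crank /nutilde mu_cat_ones // -if_neg -lt0n m0.
by rewrite count_cat count_nseq ltnS leqn0 (gtn_eqF m0) mul0n addn0.
Qed.

(** For a fixed number m of ones, x marks the parts counted by [nutilde], which makes the crank
    weight multiplicative. *)
Definition crank_wt m k : A := (if (m < k)%N then x else 1) * Q ^+ k.

Lemma prod_crank_wt m s :
  \prod_(p <- s) crank_wt m p = x ^+ count (fun k => m < k)%N s * Q ^+ psize s.
Proof.
elim: s => [|k s IH]; first by rewrite big_nil mulr1.
rewrite big_cons IH /= exprD exprD /crank_wt.
by case: ltnP => _; rewrite ?expr0 ?expr1; ring.
Qed.

(** Parts up to m give factors of (Q)_m and larger ones factors of (xQ; Q); the minimum carries the
    induction through the stage n < m, where only the former occur. *)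
Lemma prod_crank_wt_from2 m n : (0 < m)%N ->
  (\prod_(k <- parts_from2 n) (1 - crank_wt m k)) * (1 - Q) * qpoch (x * Q) Q (minn m n.+1)
  = qpoch Q Q (minn m n.+1) * qpoch (x * Q) Q n.+1.
Proof.
move=> m0; elim: n => [|n IH].
  rewrite (minn_idPr m0) big_nil mul1r !qpochS !qpoch0; ring.
rewrite parts_from2S big_cons /crank_wt; case: ltnP => mn.
  rewrite ltnS in mn; rewrite (minn_idPl mn) in IH.
  rewrite [in RHS]qpochS [RHS]mulrA -IH exprS; ring.
rewrite (minn_idPr (ltnW mn)) in IH.
rewrite [qpoch (x * Q) Q n.+2]qpochS [qpoch Q Q n.+2]qpochS [RHS]mulrACA -IH exprS; ring.
Qed.

Variable M : nat.
Hypotheses (ux : x \is a GRing.unit) (QM : Q ^+ M = 0) (M1 : (1 < M)%N).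

Definition crank_gf : A :=
  \sum_(s <- plist (fun=> M) (parts_upto M)) x ^ crank s * Q ^+ psize s.

Let uQ n : qpoch Q Q n \is a GRing.unit := qpoch_unit Q n QM.

Let Qk_nilp k : (0 < k)%N -> (Q ^+ k) ^+ M = 0.
Proof. by case: k => // k _; rewrite exprS; apply: exprM_nilp. Qed.

Let sumMS (F : nat -> A) : \sum_(m < M) F m = F 0%N + \sum_(i < M.-1) F i.+1.
Proof.
suff h n : (1 < n)%N -> \sum_(m < n) F m = F 0%N + \sum_(i < n.-1) F i.+1 by apply: h M1.
by case: n => // n _; rewrite big_ord_recl.
Qed.

Let nilp_wt m n k : k \in parts_from2 n -> crank_wt m k ^+ M = 0.
Proof. by case/mapP=> j _ ->; rewrite /crank_wt mulrC; apply/exprM_nilp/Qk_nilp. Qed.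

Lemma sum_crank_wt m n : (0 < m <= n.+1)%N ->
  (\sum_(s <- plist (fun=> M) (parts_from2 n)) \prod_(p <- s) crank_wt m p) *
  (qpoch Q Q m * qpoch (x * Q) Q n.+1) = (1 - Q) * qpoch (x * Q) Q m.
Proof.
case/andP=> m0 mn; have := prod_crank_wt_from2 n m0.
rewrite (minn_idPl mn) => <-; rewrite mulrA mulrA sum_plist_prod ?mul1r // => k.
exact: nilp_wt.
Qed.

(** Partitions with largest part l >= 2 and no ones give (1 - Q) (xQ)^l / (Q)_l. The terms l = 0 and
    l = 1 of the right side give 1 - Q + xQ where the empty partition gives 1, whence the
    correction. *)
Lemma sum_largest n : \sum_(s <- plist (fun=> M) (parts_from2 n)) x ^+ head 0%N s * Q ^+ psize s
  = (1 - Q) * (\sum_(l < n.+2) (x * Q) ^+ l / qpoch Q Q l) - x * Q + Q.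
Proof.
have u1 : 1 - Q \is a GRing.unit by apply: unit_1B_nilp QM.
elim: n => [|n IH].
  rewrite sum_plist_nil !big_ord_recl big_ord0 !qpochS qpoch0 !mul1r expr0 expr1 !mulr1 invr1 addr0.
  by rewrite mulrDr mulr1 mulrCA divrr // mulr1; ring.
rewrite parts_from2S sum_plist big_ord_recr /= mulrDr.
rewrite [RHS](_ : _ = ((1 - Q) * (\sum_(l < n.+2) (x * Q) ^+ l / qpoch Q Q l) - x * Q + Q)
   + (1 - Q) * ((x * Q) ^+ n.+2 / qpoch Q Q n.+2)); last by ring.
rewrite -IH (sumMS (fun m => \sum_(s <- plist (fun=> M) (parts_from2 n))
  x ^+ head 0%N (nseq m n.+2 ++ s) * Q ^+ psize (nseq m n.+2 ++ s))); congr (_ + _).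
set P := \sum_(s <- plist (fun=> M) (parts_from2 n)) Q ^+ psize s.
(* With m = n + 1 no part exceeds m, so the crank weight is Q^k and [sum_crank_wt] evaluates P. *)
have PE : P * qpoch Q Q n.+1 = 1 - Q.
  have := @sum_crank_wt n.+1 n; rewrite ltnS leqnn => /(_ isT).
  have -> : \sum_(s <- plist (fun=> M) (parts_from2 n)) \prod_(p <- s) crank_wt n.+1 p = P.
    rewrite /P !big_seq; apply: eq_bigr => s; rewrite mem_plist; last first.
      rewrite /parts_from2 sorted_map; apply: sub_sorted (parts_upto_sorted n) => i j /=.
      by rewrite ltnS.
    case/and3P=> _ sa _; rewrite prod_crank_wt (_ : count _ s = 0)%N ?expr0 ?mul1r //.
    apply/eqP; rewrite -leqn0 leqNgt -has_count; apply/hasPn => k /(allP sa) /mapP[j].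
    by rewrite mem_parts_upto => /andP[_ jn] ->; rewrite -leqNgt ltnS.
  have ux' : qpoch (x * Q) Q n.+1 \is a GRing.unit.
    by apply: (@qpoch_unit _ _ _ M); rewrite mulrC; apply: exprM_nilp.
  by rewrite mulrA => /(mulIr ux').
set y := Q ^+ n.+2; have yM : y ^+ M = 0 by apply: Qk_nilp.
have uy : 1 - y \is a GRing.unit by apply: unit_1B_nilp yM.
have gE : (\sum_(i < M.-1) y ^+ i.+1) * (1 - y) = y.
  have := geometric_nilp yM; rewrite (sumMS (fun m => y ^+ m)) expr0 mulrDl => e.
  by apply: (addrI (1 * (1 - y))); rewrite e; ring.
transitivity (x ^+ n.+2 * ((\sum_(i < M.-1) y ^+ i.+1) * P)).
  rewrite mulr_suml mulr_sumr; apply: eq_bigr => i _; rewrite mulr_sumr mulr_sumr.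
  apply: eq_bigr => s _.
  by rewrite /psize sumn_cat sumn_nseq exprD exprM.
apply: (mulIr uy); apply: (mulIr (uQ n.+1)).
rewrite [LHS](_ : _ = x ^+ n.+2 * ((\sum_(i < M.-1) y ^+ i.+1) * (1 - y)) * (P * qpoch Q Q n.+1)).
  have e2 : qpoch Q Q n.+1 * (1 - y) = qpoch Q Q n.+2 by rewrite [RHS]qpochS -exprS.
  rewrite gE PE [RHS](_ : _ = (1 - Q) * (x * Q) ^+ n.+2 / qpoch Q Q n.+2 * (qpoch Q Q n.+1 * (1 - y))).
    by rewrite e2 divrK // exprMn -/y; ring.
  ring.
ring.
Qed.

(* The correction (x - 1) Q comes from the partition (1), whose crank is -1. *)
Lemma crank_gfE :
  (crank_gf + (x - 1) * Q) * (qpoch (x * Q) Q M * qpoch (x^-1 * Q) Q M) = qpoch Q Q M.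
Proof.
have ME := prednK (ltnW M1); set n := M.-1 in ME.
have nx : (x * Q) ^+ M = 0 by rewrite mulrC; apply: exprM_nilp.
have nxi : (x^-1 * Q) ^+ M = 0 by rewrite mulrC; apply: exprM_nilp.
set Z := qpoch (x * Q) Q M; have uZ : Z \is a GRing.unit by apply: qpoch_unit nx.
(* Without ones the crank is the largest part; i + 1 ones contribute x^-(i+1), and the other parts
   their multiplicative weight. *)
have CE : crank_gf = (1 - Q) * (\sum_(l < M) (x * Q) ^+ l / qpoch Q Q l) - x * Q + Q +
   \sum_(i < n) (x^-1 * Q) ^+ i.+1 * ((1 - Q) * qpoch (x * Q) Q i.+1 / (qpoch Q Q i.+1 * Z)).
  rewrite /crank_gf -{2}ME parts_upto_from2 sum_plist_cat.
  transitivity (\sum_(s <- plist (fun=> M) (parts_from2 n)) (x ^+ head 0%N s * Q ^+ psize s +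
      \sum_(i < n) (x^-1 * Q) ^+ i.+1 * \prod_(p <- s) crank_wt i.+1 p)).
    rewrite !big_seq; apply: eq_bigr => s /plist_from2_gt1 hs.
    rewrite sum_plist (sumMS (fun m => \sum_(t <- plist (fun=> M) [::])
      x ^ crank (s ++ (nseq m 1%N ++ t)) * Q ^+ psize (s ++ (nseq m 1%N ++ t)))); congr (_ + _).
      by rewrite sum_plist_nil /= cats0 crank_no_ones.
    apply: eq_bigr => i _; rewrite sum_plist_nil cats0 crank_cat_ones //.
    rewrite exprzDr // prod_crank_wt /psize sumn_cat sumn_nseq mul1n exprD.
    rewrite exprMn exprVn -exprnN -exprnP.
    by move: (x ^- i.+1) => t; ring.
  rewrite big_split /= sum_largest ME big_ord_recr /= nx mul0r addr0; congr (_ + _).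
  rewrite exchange_big /=; apply: eq_bigr => i _; rewrite -mulr_sumr; congr (_ * _).
  have hi : (0 < i.+1 <= n.+1)%N by have := ltn_ord i; lia.
  have := sum_crank_wt hi.
  rewrite ME -/Z => <-; rewrite mulrK // unitrM uQ uZ //.
have s1 : (\sum_(l < M) (x * Q) ^+ l / qpoch Q Q l) * Z = 1.
  have := qbinomial 1 0 QM nx; rewrite mul1r mul0r oppr0 -/Z.
  have -> : qpoch 0 Q M = 1 by rewrite /qpoch big1 // => i _; rewrite mul0r subr0.
  move=> <-; congr (_ * _); apply: eq_bigr => l _; rewrite big1 ?mul1r // => i _.
  by rewrite mul0r addr0.
(* This sums over the number of ones: for c = -xQ and z = Q/x the products in the series are (xQ;
   Q)_l and the value is (Q^2; Q) / (Q/x; Q). *)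
have := qbinomial 1 (- (x * Q)) QM nxi; rewrite mul1r.
have -> : - (- (x * Q) * (x^-1 * Q)) = Q * Q.
  by rewrite mulNr opprK mulrACA divrr // mul1r.
rewrite /qbin_series => s2.
have s2' : qpoch Q Q M = (1 - Q) * qpoch (Q * Q) Q M.
  by rewrite -qpochSl; apply/esym/qpoch_stable.
rewrite s2' -s2 CE [(Z * _)]mulrC mulrA [LHS]mulrAC [RHS]mulrA; congr (_ * _).
rewrite [X in X * Z](_ : _ = (1 - Q) * (\sum_(l < M) (x * Q) ^+ l / qpoch Q Q l) +
   \sum_(i < n) (x^-1 * Q) ^+ i.+1 * ((1 - Q) * qpoch (x * Q) Q i.+1 / (qpoch Q Q i.+1 * Z)));
  last by ring.
rewrite mulrDl -mulrA s1 mulr_suml -[in RHS]ME big_ord_recl big_ord0 expr0 qpoch0 divr1 !mulr1.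
rewrite mulrDr mulr1 mulr_sumr; congr (_ + _); apply: eq_bigr => i _.
rewrite /= invrM ?uQ // (_ : \prod_(_ < _) _ = qpoch (x * Q) Q i.+1); last first.
  by apply: eq_bigr => j _; rewrite mulNr.
rewrite [LHS](_ : _ = (Z / Z) * ((1 - Q) * (qpoch (x * Q) Q i.+1 * (x^-1 * Q) ^+ i.+1 / qpoch Q Q i.+1))).
  by rewrite divrr // mul1r.
ring.
Qed.

End CrankGF.

(** * The srank *)

Section Srank.
Implicit Types s r t : seq nat.

Fixpoint altsum s : int := if s is a :: r then (Posz a - altsum r)%R else 0%R.

(* Half the srank: a new largest part a turns the height c of each of the first a columns
   into c + 1, and altsum r is the number of odd columns of r. *)
Fixpoint hsrank s : int :=
  if s is a :: r then (hsrank r + altsum r - Posz a./2)%R else 0%R.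

(** A new largest part a flips the parity of the first a columns, and the columns beyond them are
    empty. *)
Lemma count_odd_conj n s : sorted geq s -> head 0 s <= n ->
  Posz (count (fun j => odd (count (fun x => j <= x) s)) (iota 1 n)) = altsum s.
Proof.
elim: s n => [|a r IH] n; first by rewrite /= count_pred0.
move=> par; have sr := path_sorted par; move: par.
rewrite /= (path_sortedE (rev_trans leq_trans)) => /andP[ra _] an.
rewrite -(subnKC an) iotaD count_cat.
have -> : count (fun j => odd ((j <= a) + count (fun x => j <= x) r)) (iota (1 + a) (n - a)) = 0.
  apply/eqP; rewrite -leqn0 leqNgt -has_count; apply/hasPn => j; rewrite mem_iota => /andP[aj _].
  have -> : (j <= a) = false by lia.
  rewrite (_ : count _ r = 0) //; apply/eqP; rewrite -leqn0 leqNgt -has_count.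
  by apply/hasPn => x /(allP ra) /=; lia.
have ha : head 0 r <= a by case: (r) ra => //= b r' /andP[].
rewrite addn0 -(IH a sr ha) -[X in (Posz X - _)%R](size_iota 1 a).
rewrite -(count_predC (fun j => odd (count (fun x => j <= x) r)) (iota 1 a)) PoszD.
set X := (X in (X + _ - X)%R); rewrite [(X + _)%R]addrC addrK; congr Posz.
apply: eq_in_count => j; rewrite mem_iota => /andP[_ ja].
by have -> : (j <= a) = true by lia.
Qed.

Lemma nodd_conj s : sorted geq s -> Posz (nodd (conj s)) = altsum s.
Proof. by move=> ss; rewrite /nodd /conj count_map -(count_odd_conj ss (leqnn _)). Qed.

Lemma nodd_altsum s : (Posz (nodd s) - altsum s = hsrank s *+ 2)%R.
Proof.
elim: s => [//|a r IH]; rewrite /= mulrnDl mulrnDl -IH PoszD.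
have : Posz a = (Posz (odd a) + Posz a./2 * 2)%R by have := odd_double_half a; lia.
by lia.
Qed.

Lemma srankE s : sorted geq s -> srank s = (hsrank s *+ 2)%R.
Proof. by move=> ss; rewrite /srank nodd_conj // nodd_altsum. Qed.

Lemma half_srank s : sorted geq s -> (srank s %/ 2)%Z = hsrank s.
Proof. by move=> ss; rewrite srankE //; lia. Qed.

Lemma altsum_pair t k r : altsum (t ++ [:: k, k & r]) = altsum (t ++ r).
Proof. by elim: t => [|a t IH] /=; rewrite ?IH //; lia. Qed.

(** An equal pair raises column heights by two, and even parts do not count as odd: neither term of
    the srank changes. *)
Lemma hsrank_even_pair t k r :
  hsrank (t ++ [:: k.*2, k.*2 & r]) = hsrank (t ++ r).
Proof.
elim: t => [|a t IH] /=; last by rewrite IH altsum_pair.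
by rewrite doubleK; lia.
Qed.

Lemma psize_even_pair t k r :
  psize (t ++ [:: k.*2, k.*2 & r]) = 4 * k + psize (t ++ r).
Proof. by rewrite /psize !sumn_cat /=; lia. Qed.

End Srank.

(** * Splitting off pairs of equal even parts *)

Section Pi1Split.
Local Open Scope ring_scope.

(** [pi1] with a free cutoff n in place of the largest part, for induction on n. *)
Definition even_halves n (s : seq nat) :=
  flatten [seq nseq (mult s (2 * k))./2 k | k <- parts_upto n].

Lemma even_halves_le n m (s : seq nat) : (n <= m)%N ->
  (forall k, (n < k)%N -> mult s (2 * k) = 0%N) -> even_halves m s = even_halves n s.
Proof.
move=> + h; elim: m => [|m IH]; first by rewrite leqn0 => /eqP ->.
rewrite leq_eqVlt => /orP[/eqP -> //|]; rewrite ltnS => nm.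
by rewrite /even_halves parts_uptoS /= h ?ltnS // -/(even_halves m s) IH.
Qed.

Lemma pi1_even_halves n (s : seq nat) : sorted geq s -> all (fun k => k <= 2 * n)%N s ->
  pi1 s = even_halves n s.
Proof.
move=> ss sa; rewrite -[pi1 s]/(even_halves (largest s) s).
have hl k : (largest s < k)%N -> mult s (2 * k) = 0%N.
  move=> lk; apply/count_memPn/negP; case: s ss lk {sa} => // a r /= par ak.
  rewrite inE => /orP[|kr]; first by lia.
  move: par; rewrite (path_sortedE (rev_trans leq_trans)) => /andP[/allP/(_ _ kr) /=]; lia.
have hn k : (n < k)%N -> mult s (2 * k) = 0%N.
  by move=> nk; apply/count_memPn/negP => /(allP sa) /=; lia.
have [h|/ltnW h] := leqP n (largest s); first exact: even_halves_le.
by apply/esym/even_halves_le.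
Qed.

Lemma even_halves_cons n m m' (s : seq nat) : all (fun k => k <= 2 * n)%N s ->
  even_halves n.+1 (nseq m n.+1.*2 ++ nseq m' n.*2.+1 ++ s) = nseq m./2 n.+1 ++ even_halves n s.
Proof.
move=> sa; rewrite /even_halves parts_uptoS /=; congr (nseq _./2 _ ++ flatten _).
  rewrite /mult !count_cat !count_nseq /= (_ : count_mem _ s = 0)%N.
    by have -> : (n.*2.+1 == 2 * n.+1)%N = false; [lia|have -> : (n.+1.*2 == 2 * n.+1)%N; lia].
  by apply/count_memPn/negP => /(allP sa); lia.
apply/eq_in_map => k; rewrite mem_parts_upto => /andP[k0 kn].
rewrite /mult !count_cat !count_nseq /=.
have -> : (n.+1.*2 == 2 * k)%N = false by lia.
by have -> : (n.*2.+1 == 2 * k)%N = false by lia.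
Qed.

Lemma plist_upto_le b n s : s \in plist b (parts_upto n) -> all (fun k => k <= n)%N s.
Proof.
rewrite mem_plist ?parts_upto_sorted // => /and3P[_ sa _]; apply/allP => k /(allP sa) /=.
by rewrite mem_parts_upto => /andP[].
Qed.

Lemma sum_ord_double (V : nmodType) n (F : nat -> V) :
  \sum_(m < 2 * n) F m = \sum_(i < n) (F i.*2 + F i.*2.+1).
Proof.
elim: n => [|n IH]; first by rewrite muln0 !big_ord0.
by rewrite mulnS add2n !big_ord_recr /= IH mul2n addrA.
Qed.

Variables (A : comUnitRingType) (q : A) (L : nat).

(** A multiplicity below 2 L is twice a number below L plus 0 or 1; this remainder is what an even
    part keeps once its pairs are removed. *)
Definition norep_even_bound k := if odd k then (2 * L)%N else 2.

Lemma sum_plist_norep_odd (V : nmodType) k ks (F : seq nat -> V) : odd k ->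
  \sum_(s <- plist norep_even_bound (k :: ks)) F s =
  \sum_(m < 2 * L) \sum_(s <- plist norep_even_bound ks) F (nseq m k ++ s).
Proof.
by move=> ok; rewrite sum_plist; have -> : norep_even_bound k = (2 * L)%N by rewrite /norep_even_bound ok.
Qed.

Lemma sum_plist_norep_even (V : nmodType) k ks (F : seq nat -> V) : ~~ odd k ->
  \sum_(s <- plist norep_even_bound (k :: ks)) F s =
  \sum_(m < 2) \sum_(s <- plist norep_even_bound ks) F (nseq m k ++ s).
Proof.
by move=> /negPf ok; rewrite sum_plist; have -> : norep_even_bound k = 2 by rewrite /norep_even_bound ok.
Qed.

(** The multiplicity of 2 (n + 1) is written 2 i + e: the pairs become i parts n + 1 of pi_1 and
    contribute q^(4 (n+1) i). The functions [g] and [W] stay general so that the induction can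
    absorb the blocks already chosen into them. *)
Lemma pi1_split n (g W : seq nat -> A) :
  (forall t k r, W (t ++ [:: k.*2, k.*2 & r]) = q ^+ (4 * k) * W (t ++ r)) ->
  \sum_(s <- plist (fun=> 2 * L)%N (parts_upto (2 * n))) g (pi1 s) * W s =
  (\sum_(p <- plist (fun=> L) (parts_upto n)) g p * (q ^+ 4) ^+ psize p) *
  \sum_(s <- plist norep_even_bound (parts_upto (2 * n))) W s.
Proof.
move=> hW.
have -> : \sum_(s <- plist (fun=> 2 * L)%N (parts_upto (2 * n))) g (pi1 s) * W s =
  \sum_(s <- plist (fun=> 2 * L)%N (parts_upto (2 * n))) g (even_halves n s) * W s.
  rewrite !big_seq; apply: eq_bigr => s hs; rewrite (@pi1_even_halves n) //.
    by move: hs; rewrite mem_plist ?parts_upto_sorted // => /and3P[].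
  by apply: plist_upto_le hs.
elim: n g W hW => [|n IH] g W hW.
  rewrite !sum_plist_nil /even_halves /= expr0 mulr1 //.
have -> : (2 * n.+1 = (2 * n).+2)%N by lia.
rewrite !parts_uptoS sum_plist_norep_even; last by lia.
rewrite !sum_plist.
set w := fun e m' s => W (nseq e (2 * n).+2 ++ nseq m' (2 * n).+1 ++ s).
have WE i e m' s : W (nseq (i.*2 + e) (2 * n).+2 ++ nseq m' (2 * n).+1 ++ s)
    = q ^+ (4 * (n.+1 * i)) * w e m' s.
  rewrite /w; elim: i => [|i IHi]; first by rewrite muln0 muln0 mul1r.
  rewrite doubleS !addSn /=; have := hW [::] n.+1; rewrite /= doubleS -mul2n => ->.
  by rewrite IHi mulrA -exprD; congr (_ ^+ _ * _); lia.
have -> : \sum_(m < 2 * L) \sum_(s <- plist (fun=> 2 * L)%N ((2 * n).+1 :: parts_upto (2 * n)))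
   g (even_halves n.+1 (nseq m (2 * n).+2 ++ s)) * W (nseq m (2 * n).+2 ++ s) =
   \sum_(i < L) \sum_(e < 2) \sum_(m' < 2 * L)
     q ^+ (4 * (n.+1 * i)) * \sum_(s <- plist (fun=> 2 * L)%N (parts_upto (2 * n)))
     g (nseq i n.+1 ++ even_halves n s) * w e m' s.
  rewrite (sum_ord_double L (fun m => \sum_(s <- plist (fun=> 2 * L)%N ((2 * n).+1 :: parts_upto (2 * n)))
   g (even_halves n.+1 (nseq m (2 * n).+2 ++ s)) * W (nseq m (2 * n).+2 ++ s))).
  apply: eq_bigr => i _; rewrite !big_ord_recl big_ord0 addr0.
  have st e : (e < 2)%N -> \sum_(s <- plist (fun=> 2 * L)%N ((2 * n).+1 :: parts_upto (2 * n)))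
     g (even_halves n.+1 (nseq (i.*2 + e) (2 * n).+2 ++ s)) * W (nseq (i.*2 + e) (2 * n).+2 ++ s) =
     \sum_(m' < 2 * L)
     q ^+ (4 * (n.+1 * i)) * \sum_(s <- plist (fun=> 2 * L)%N (parts_upto (2 * n)))
     g (nseq i n.+1 ++ even_halves n s) * w e m' s.
    move=> e2; rewrite sum_plist; apply: eq_bigr => m' _; rewrite mulr_sumr !big_seq.
    apply: eq_bigr => s /plist_upto_le hs; rewrite WE.
    have := @even_halves_cons n (i.*2 + e) m' s hs; rewrite doubleS -(mul2n n) => ->.
    by rewrite (_ : (i.*2 + e)./2 = i) //; [ring|lia].
  by have := st 0%N isT; have := st 1%N isT; rewrite addn0 addn1 => -> ->.
rewrite mulr_suml; apply: eq_bigr => i _.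
rewrite mulr_sumr; apply: eq_bigr => e _.
rewrite sum_plist_norep_odd; last by lia.
rewrite mulr_sumr; apply: eq_bigr => m' _.
rewrite (IH (fun p => g (nseq i n.+1 ++ p)) (w e m')); last first.
  move=> t k r; have := hW (nseq e (2 * n).+2 ++ nseq m' (2 * n).+1 ++ t) k r.
  by rewrite /w -!catA.
rewrite mulrA; congr (_ * _); rewrite mulr_sumr; apply: eq_bigr => p _.
by rewrite /psize sumn_cat sumn_nseq exprD -!exprM; ring.
Qed.

End Pi1Split.

(** * The srank over partitions without repeated even parts *)

Section SrankGF.
Local Open Scope ring_scope.
Variables (A : comUnitRingType) (u q : A) (M : nat).
Hypotheses (uu : u \is a GRing.unit) (qM : q ^+ M = 0).

Definition srank_wt s : A := u ^ hsrank s * q ^+ psize s.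
Let V s : A := u ^ (hsrank s + altsum s) * q ^+ psize s.
Let L := (M + M)%N.

Lemma srank_wt_even_pair t k r :
  srank_wt (t ++ [:: k.*2, k.*2 & r]) = q ^+ (4 * k) * srank_wt (t ++ r).
Proof.
by rewrite /srank_wt hsrank_even_pair psize_even_pair exprD mulrCA.
Qed.

Let W_cons a r : srank_wt (a :: r) = u ^- a./2 * q ^+ a * V r.
Proof.
rewrite /srank_wt /V /= exprzDr // exprD -exprnN.
by move: (u ^- _) => t; ring.
Qed.

Let V_cons a r : V (a :: r) = u ^+ (a - a./2) * q ^+ a * srank_wt r.
Proof.
rewrite /srank_wt /V /=.
have -> : hsrank r + altsum r - (a./2)%:Z + (a%:Z - altsum r) = hsrank r + (a - a./2)%N%:Z.
  by lia.
by rewrite exprzDr // exprD -exprnP; ring.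
Qed.

Definition srank_gf n : A := \sum_(s <- plist (norep_even_bound L) (parts_upto (2 * n))) srank_wt s.
Let Vgf n : A := \sum_(s <- plist (norep_even_bound L) (parts_upto (2 * n))) V s.

Let G n : A := \sum_(i < L) (u * (q ^+ 2 * (q ^+ 4) ^+ n)) ^+ i.

Let G_inv n : G n * (1 - u * q ^+ 2 * (q ^+ 4) ^+ n) = 1.
Proof.
rewrite -mulrA /G geometric_nilp // mulrC; do 2!apply: exprM_nilp.
by rewrite -exprM (expr_nilp_ge qM) // /L; lia.
Qed.

(** Equal odd parts 2 n + 1 are taken in pairs: each pair multiplies either weight by u q^(4n+2),
    summed by [G], and a single copy left over exchanges the two weights up to a monomial. *)
Let odd_step n r :
  (\sum_(m < 2 * L) srank_wt (nseq m n.*2.+1 ++ r) = G n * (srank_wt r + u ^- n * q ^+ n.*2.+1 * V r))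
  * (\sum_(m < 2 * L) V (nseq m n.*2.+1 ++ r) = G n * (V r + u ^+ n.+1 * q ^+ n.*2.+1 * srank_wt r)).
Proof.
have ev : (n.*2.+1)./2 = n by rewrite -addn1; lia.
have ev' : (n.*2.+1 - n = n.+1)%N by lia.
have uV : u ^- n * u ^+ n = 1 by rewrite mulVr // unitrX.
have pW r' : srank_wt [:: n.*2.+1, n.*2.+1 & r'] = u * (q ^+ 2 * (q ^+ 4) ^+ n) * srank_wt r'.
  rewrite W_cons V_cons ev ev' -exprM -exprD [LHS](_ : _ = (u ^- n * u ^+ n) * u * (q ^+ n.*2.+1 * q ^+ n.*2.+1) * srank_wt r').
    by rewrite uV mul1r -exprD; congr (_ * _ ^+ _ * _); lia.
  by rewrite [u ^+ n.+1]exprS; ring.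
have pV r' : V [:: n.*2.+1, n.*2.+1 & r'] = u * (q ^+ 2 * (q ^+ 4) ^+ n) * V r'.
  rewrite V_cons W_cons ev ev' -exprM -exprD [LHS](_ : _ = (u ^- n * u ^+ n) * u * (q ^+ n.*2.+1 * q ^+ n.*2.+1) * V r').
    by rewrite uV mul1r -exprD; congr (_ * _ ^+ _ * _); lia.
  by rewrite [u ^+ n.+1]exprS; ring.
have kW i r' : srank_wt (nseq i.*2 n.*2.+1 ++ r') = (u * (q ^+ 2 * (q ^+ 4) ^+ n)) ^+ i * srank_wt r'.
  by elim: i => [|i IH]; rewrite ?mul1r // doubleS /= pW IH [_ ^+ i.+1]exprS; ring.
have kV i r' : V (nseq i.*2 n.*2.+1 ++ r') = (u * (q ^+ 2 * (q ^+ 4) ^+ n)) ^+ i * V r'.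
  by elim: i => [|i IH]; rewrite ?mul1r // doubleS /= pV IH [_ ^+ i.+1]exprS; ring.
split; rewrite (sum_ord_double L (fun m => _ (nseq m n.*2.+1 ++ r))) /G mulr_suml;
  apply: eq_bigr => i _ /=; rewrite ?W_cons ?V_cons ?ev ?ev' kW kV; ring.
Qed.

(* Adding a part exchanges the weights u^hsrank and u^(hsrank + altsum) up to monomials,
   whence the coupled recursion for their generating functions. *)
Lemma srank_gf_rec n :
  ((1 - u * q ^+ 2 * (q ^+ 4) ^+ n) * srank_gf n.+1 =
    (1 + q ^+ (4 * n + 3)) * srank_gf n +
    (q ^+ (2 * n).+1 + u^-1 * q ^+ (2 * n).+2) * (u ^- n * Vgf n)) *
  ((1 - u * q ^+ 2 * (q ^+ 4) ^+ n) * (u ^- n.+1 * Vgf n.+1) =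
    (u^-1 + q ^+ (4 * n + 3)) * (u ^- n * Vgf n) +
    (q ^+ (2 * n).+1 + q ^+ (2 * n).+2) * srank_gf n).
Proof.
have e0 : odd (2 * n).+2 = false by lia.
have e1 : odd (2 * n).+1 = true by lia.
have h2 : ((2 * n).+2)./2 = n.+1 by lia.
have h2' : ((2 * n).+2 - n.+1 = n.+1)%N by lia.
have uV : u ^- n * u ^+ n = 1 by rewrite mulVr // unitrX.
have uV1 : u^-1 * u = 1 by rewrite mulVr.
have uS : u ^- n.+1 = u^-1 * u ^- n by rewrite exprS invrM ?unitrX // mulrC.
pose S := \sum_(m < 2 * L) \sum_(s <- plist (norep_even_bound L) (parts_upto (2 * n)))
    srank_wt (nseq m (2 * n).+1 ++ s).
pose T := \sum_(m < 2 * L) \sum_(s <- plist (norep_even_bound L) (parts_upto (2 * n)))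
    V (nseq m (2 * n).+1 ++ s).
have SE : S = G n * (srank_gf n + u ^- n * q ^+ (2 * n).+1 * Vgf n).
  rewrite /S exchange_big /= /srank_gf /Vgf mulr_sumr -big_split mulr_sumr.
  by apply: eq_bigr => s _; rewrite (mul2n n) (odd_step n s).1.
have TE : T = G n * (Vgf n + u ^+ n.+1 * q ^+ (2 * n).+1 * srank_gf n).
  rewrite /T exchange_big /= /srank_gf /Vgf mulr_sumr -big_split mulr_sumr.
  by apply: eq_bigr => s _; rewrite (mul2n n) (odd_step n s).2.
have SS : srank_gf n.+1 = S + u ^- n.+1 * q ^+ (2 * n).+2 * T.
  rewrite /srank_gf (_ : 2 * n.+1 = (2 * n).+2)%N; last by lia.
  rewrite !parts_uptoS sum_plist_norep_even ?e0 // !big_ord_recl big_ord0 addr0 /=.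
  rewrite !sum_plist_norep_odd ?e1 // /S /T; congr (_ + _).
  rewrite mulr_sumr; apply: eq_bigr => m _; rewrite mulr_sumr.
  by apply: eq_bigr => s _; rewrite W_cons h2.
have TT : Vgf n.+1 = T + u ^+ n.+1 * q ^+ (2 * n).+2 * S.
  rewrite /Vgf (_ : 2 * n.+1 = (2 * n).+2)%N; last by lia.
  rewrite !parts_uptoS sum_plist_norep_even ?e0 // !big_ord_recl big_ord0 addr0 /=.
  rewrite !sum_plist_norep_odd ?e1 // /S /T; congr (_ + _).
  rewrite mulr_sumr; apply: eq_bigr => m _; rewrite mulr_sumr.
  by apply: eq_bigr => s _; rewrite V_cons h2 h2'.
have GI := G_inv n; set D := 1 - u * q ^+ 2 * (q ^+ 4) ^+ n in GI *.
have q43 : q ^+ (4 * n + 3) = q ^+ (2 * n).+1 * q ^+ (2 * n).+2.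
  by rewrite -exprD; congr (_ ^+ _); lia.
move: uV uV1 uS; rewrite SS TT SE TE q43 exprS.
move: (u ^- n.+1) (u^-1) (u ^- n) => c b a uV uV1 ->.
set X := srank_gf n; set Y := Vgf n; move: (q ^+ (2 * n).+1) (q ^+ (2 * n).+2) => s t.
move: GI uV; move: (G n) (u ^+ n) => g p GI uV.
split.
  rewrite [LHS](_ : _ = g * D * (X + a * s * Y + b * a * t * Y + b * u * (a * p) * (s * t) * X)); last by ring.
  by rewrite GI uV uV1; ring.
rewrite [LHS](_ : _ = g * D * (b * a * Y + b * u * (a * p) * (s + t) * X
    + b * u * (a * p) * (s * t) * (a * Y))); last by ring.
by rewrite GI uV uV1; ring.
Qed.

Let Aj j := qpoch (- q) (q ^+ 4) j.
Let Bl l : A := \prod_(i < l) (u^-1 + q * (q ^+ 4) ^+ i).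

(** The Gauss sums solve the coupled recursion: the first equation by one q-Pascal rule, the second
    by the other. *)
Lemma srank_gf_gauss n :
  (srank_gf n * qpoch (u * q ^+ 2) (q ^+ 4) n =
    gauss_sum (q ^+ 4) n (fun j l => Aj j * (Bl l * (q ^+ 2) ^+ l))) *
  (u ^- n * Vgf n * qpoch (u * q ^+ 2) (q ^+ 4) n =
    gauss_sum (q ^+ 4) n (fun j l => Aj j * Bl l * (q ^+ 2) ^+ j)).
Proof.
elim: n => [|n [IH1 IH2]].
  rewrite /= /srank_gf /Vgf !sum_plist_nil /srank_wt /V /Aj /Bl !qpoch0 /= !big_ord0 addr0.
  by rewrite !expr0z !expr0 invr1 !mulr1.
have p4 k : (q ^+ 4) ^+ k = (q ^+ k) ^+ 4 by rewrite -!exprM mulnC.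
have p2 k : (q ^+ 2) ^+ k = (q ^+ k) ^+ 2 by rewrite -!exprM mulnC.
have r1 := (srank_gf_rec n).1; have r2 := (srank_gf_rec n).2.
split; rewrite qpochS mulrA.
- rewrite mulrAC [srank_gf _ * _]mulrC r1 mulrDl -!mulrA (mulrA (u ^- n)) IH1 IH2.
  rewrite -[X in _ + X]gauss_sumZ -gauss_sumZD /=; apply: eq_gauss_sum => j l jl.
  rewrite /Aj /Bl qpochS big_ord_recr /= -jl.
  rewrite (_ : (4 * (j + l) + 3 = j * 4 + l * 4 + 3)%N); last by lia.
  rewrite (_ : ((2 * (j + l)).+2 = j * 2 + l * 2 + 2)%N); last by lia.
  rewrite (_ : ((2 * (j + l)).+1 = j * 2 + l * 2 + 1)%N); last by lia.
  rewrite [(q ^+ 2) ^+ l.+1]exprS !exprD !exprM !p4 !p2.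
  move: (\prod_(_ < _) _) (qpoch _ _ _) (q ^+ j) (q ^+ l) => b a y z; ring.
rewrite mulrAC [u ^- _ * _ * _]mulrC r2 mulrDl -!mulrA (mulrA (u ^- n)) IH1 IH2.
rewrite -[X in _ + X]gauss_sumZ -gauss_sumZD gauss_sumSr; apply: eq_gauss_sum => j l jl.
rewrite /Aj /Bl qpochS big_ord_recr /= -jl.
rewrite (_ : (4 * (j + l) + 3 = j * 4 + l * 4 + 3)%N); last by lia.
rewrite (_ : ((2 * (j + l)).+2 = j * 2 + l * 2 + 2)%N); last by lia.
rewrite (_ : ((2 * (j + l)).+1 = j * 2 + l * 2 + 1)%N); last by lia.
rewrite [(q ^+ 2) ^+ j.+1]exprS !exprD !exprM !p4 !p2.
move: (\prod_(_ < _) _) (qpoch _ _ _) (q ^+ j) (q ^+ l) => b a y z; ring.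
Qed.

(** In the limit the Gauss sum factors as (-q; q^4) times the q-binomial series with v = 1/u, c = q
    and z = q^2. *)
Lemma srank_gfE :
  srank_gf L * (qpoch (u * q ^+ 2) (q ^+ 4) M * qpoch (u^-1 * q ^+ 2) (q ^+ 4) M) =
  qpoch (- q) (q ^+ 4) M * qpoch (- q ^+ 3) (q ^+ 4) M.
Proof.
have QM : (q ^+ 4) ^+ M = 0 by rewrite exprS; apply: exprM_nilp.
have zM : (q ^+ 2) ^+ M = 0 by rewrite exprS; apply: exprM_nilp.
have := (srank_gf_gauss L).1; rewrite (qpoch_stable _ QM (leq_addr M M)) => e.
rewrite mulrA e (gauss_sum_lim QM) => [|j Mj|l Ml]; last first.
- by rewrite (expr_nilp_ge zM Ml) mulr0.
- exact: qpoch_stable.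
rewrite -mulrA; congr (_ * _).
by have := qbinomial u^-1 q QM zM; rewrite -exprS => <-; congr (_ * _).
Qed.

End SrankGF.

(** * Partitions of type B *)

Section TypeB.
Implicit Types s r e t : seq nat.

(** The empty partition has no part to enlarge; the exceptional (3, 1) is its image, also of size 4
    and srank 0. *)
Definition typeB_grow e := if e is a :: r then a.+2 :: (r ++ [:: 1; 1]) else [:: 3; 1].

Definition norep_even e := all (fun k => odd k || (count_mem k e <= 1)) e.

Lemma typeB_grow_inj : injective typeB_grow.
Proof.
move=> [|a r] [|b t] //= [].
- by move=> _; case: t => [|c [|d t]].
- by move=> _; case: r => [|c [|d r]].
by move=> -> /(congr1 rev); rewrite !rev_cat => -[] /(can_inj revK) ->.
Qed.

Lemma psize_typeB_grow e : psize (typeB_grow e) = psize e + 4.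
Proof. by case: e => [//|a r]; rewrite /psize /= sumn_cat /=; lia. Qed.

Lemma hsrank_cat11 r : hsrank (r ++ [:: 1; 1]) = (hsrank r + 1)%R.
Proof.
elim: r => [//|a r IH] /=; rewrite IH altsum_pair cats0; lia.
Qed.

(** The two ones raise half the srank by 1, and the enlarged first part lowers it by 1. *)
Lemma hsrank_typeB_grow e : hsrank (typeB_grow e) = hsrank e.
Proof. by case: e => [//|a r] /=; rewrite hsrank_cat11 altsum_pair cats0; lia. Qed.

Lemma sorted_geq_ones s : sorted geq s -> 0 \notin s ->
  s = [seq x <- s | 1 < x] ++ nseq (count_mem 1 s) 1.
Proof.
elim: s => //= a s IH pas; rewrite inE negb_or => /andP[a0 s0]; have ss := path_sorted pas.
case: a a0 pas => [|[|a]] // _ pas /=; last by rewrite add0n -IH.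
have s1 : s = nseq (size s) 1.
  apply/all_pred1P/allP => x xs; move: pas; rewrite (path_sortedE (rev_trans leq_trans)).
  case/andP=> /allP/(_ _ xs) /= x1 _; case: x xs x1 => [|[|x]] //= x0.
  by rewrite x0 in s0.
have f0 : [seq x <- s | 1 < x] = [::] by rewrite s1; elim: (size s).
by rewrite f0 /= s1 count_nseq /= mul1n.
Qed.

Lemma count_le2 s : 0 \notin s -> count (fun x => 2 <= x) s + count_mem 1 s = count (fun x => 1 <= x) s.
Proof.
elim: s => //= a s IH; rewrite inE negb_or => /andP[a0 /IH <-].
by case: a a0 => [|[|a]] //= _; lia.
Qed.

Lemma lam_conj s : 1 < head 0 s ->
  (lam (conj s) 1 = count (fun x => 1 <= x) s) * (lam (conj s) 2 = count (fun x => 2 <= x) s).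
Proof. by rewrite /conj; case: (head 0 s) => [|[|n]]. Qed.

(** The first two columns differ by the number of ones, so the condition on the conjugate asks for
    two ones. *)
Lemma typeBE s : sorted geq s -> 0 \notin s -> typeB s = (s == [:: 3; 1]) ||
  [&& psize s != 4, nth 0 s 1 + 2 <= head 0 s, 2 <= count_mem 1 s,
      ~~ ((head 0 s == nth 0 s 1 + 2) && ~~ odd (nth 0 s 1)) & norep_even s].
Proof.
move=> ss s0; rewrite /typeB; congr (_ || _); congr (_ && _).
have -> : lam s 1 = head 0 s by case: (s).
have -> : lam s 2 = nth 0 s 1 by [].
case: (leqP (nth 0 s 1 + 2) (head 0 s)) => // h.
have h1 : 1 < head 0 s by lia.
rewrite !lam_conj // -(count_le2 s0); congr [&& true, _, ~~ (_ && _) & _]; first by lia.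
by apply/eqP/eqP; lia.
Qed.

Lemma sorted_geq_cons a r : sorted geq (a :: r) = (head 0 r <= a) && sorted geq r.
Proof. by case: r. Qed.

Lemma sorted_geq_cat1 r : sorted geq (r ++ [:: 1; 1]) = sorted geq r && (0 \notin r).
Proof.
elim: r => [//|a r IH]; rewrite cat_cons !sorted_geq_cons IH inE negb_or.
case: r {IH} => [|b r] /=; first by case: a.
by rewrite inE negb_or; case: b; case: a => //= *; rewrite ?andbF ?andbT // andbA.
Qed.

Lemma typeB_grow_valid e : sorted geq e -> 0 \notin e -> norep_even e ->
  [/\ sorted geq (typeB_grow e), 0 \notin typeB_grow e & typeB (typeB_grow e)].
Proof.
case: e => [//|a r] se e0 ne.
move: (e0); rewrite inE negb_or => /andP[a0 r0].
move: (se); rewrite sorted_geq_cons => /andP[ha sr].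
have le_ra k : k \in r -> k <= a.
  by move: se; rewrite /= (path_sortedE (rev_trans leq_trans)) => /andP[/allP h _] /h.
have st : sorted geq (typeB_grow (a :: r)).
  rewrite /typeB_grow sorted_geq_cons sorted_geq_cat1 sr r0 !andbT.
  by case: (r) ha => //= b r'; lia.
have t0 : 0 \notin typeB_grow (a :: r) by rewrite /typeB_grow inE mem_cat (negPf r0).
split=> //; rewrite typeBE //; apply/orP; right; rewrite psize_typeB_grow.
have hn : nth 0 (r ++ [:: 1; 1]) 0 <= a by case: (r) ha => //=; lia.
apply/and5P; split.
- by rewrite /psize /=; lia.
- by rewrite /=; lia.
- by rewrite /= count_cat /=; lia.
(* Equality would force the next part to be the even number a, which would then be repeated in e. *)
- apply/negP => /andP[] /= /eqP h ev.
  have {}h : nth 0 (r ++ [:: 1; 1]) 0 = a by lia.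
  rewrite h in ev; have ar : a \in r.
    by move: ev; case: (r) h => [|b r'] /= <- // _; rewrite mem_head.
  have := allP ne a (mem_head _ _); rewrite (negPf ev) /= eqxx add1n ltnS leqNgt.
  by rewrite -has_count has_pred1 ar.
apply/allP => k; rewrite /typeB_grow inE mem_cat => hk.
case ok: (odd k) => //=; rewrite count_cat /=.
have k1 : (1 == k) = false by apply/eqP => e; rewrite -e in ok.
rewrite k1 !addn0; case: eqP => [<-|nk].
  by rewrite (_ : count_mem _ r = 0) //; apply/count_memPn/negP => /le_ra; lia.
have kr : k \in r.
  by case/orP: hk => [/eqP //|/orP[//|]]; [lia|rewrite !inE orbb eq_sym k1].
by have := allP ne k; rewrite inE kr orbT ok /= => /(_ isT); lia.
Qed.

Lemma typeB_grow_onto s : sorted geq s -> 0 \notin s -> typeB s ->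
  exists e, [/\ sorted geq e, 0 \notin e, norep_even e & s = typeB_grow e].
Proof.
move=> ss s0; rewrite typeBE // => /orP[/eqP ->|]; first by exists [::].
case/and5P=> _ h1 h2 h3 ne.
have := sorted_geq_ones ss s0; rewrite -(subnK h2) nseqD; set f := filter _ _; rewrite catA.
set s' := f ++ _ => es; have {}es : s = s' ++ [:: 1; 1] by [].
case: s' es => [|c r] es; first by rewrite es in h1.
move: h1 h3; rewrite es /= => h1 h3.
have nh : head 0 r <= nth 0 (r ++ [:: 1; 1]) 0 by case: (r).
exists ((c - 2) :: r).
have n1 : 0 < nth 0 (r ++ [:: 1; 1]) 0.
  have hin : nth 0 (r ++ [:: 1; 1]) 0 \in r ++ [:: 1; 1] by apply: mem_nth; rewrite size_cat addn2.
  by rewrite lt0n; apply: contraNneq s0 => h; rewrite es in_cons -[X in X \in r ++ _]h hin orbT.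
have sr : sorted geq r && (0 \notin r) by rewrite -sorted_geq_cat1; move: ss; rewrite es => /path_sorted.
case/andP: sr => sr r0.
have se : sorted geq (c - 2 :: r) by rewrite sorted_geq_cons sr andbT; lia.
split=> //.
- by rewrite inE negb_or r0 andbT; lia.
- apply/allP => k; rewrite inE => hk; case ok: (odd k) => //=; case: eqP => [ck|nk].
    (* The parts of r are at most c - 2, so if the even number c - 2 recurs it is the second part:
       the excluded case of type B. *)
    rewrite (_ : count_mem _ r = 0) //; apply/count_memPn/negP => kr.
    case: r {n1 sr r0 hk es} nh h1 h3 kr se => [//|b r] /= _ h1 h3 kr.
    move=> /andP[bk pr].
    have kb : k <= b.
      move: kr; rewrite inE => /orP[/eqP -> //|kr].
      by move: pr; rewrite (path_sortedE (rev_trans leq_trans)) => /andP[/allP/(_ _ kr)].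
    have bk' : b = k by lia.
    by move: h3; rewrite bk' ok andbT; lia.
  have kr : k \in r by case/orP: hk => // /eqP; lia.
  have := allP ne k; rewrite es inE mem_cat kr !orbT ok /= => /(_ isT).
  by rewrite count_cat /=; lia.
by rewrite /=; congr (_ :: _); lia.
Qed.

Lemma pi1_typeB s : sorted geq s -> 0 \notin s -> typeB s -> pi1 s = [::].
Proof.
move=> ss s0 ts.
have ne k : ~~ odd k -> mult s k <= 1.
  move=> ok; case: (boolP (k \in s)) => [ks|kn]; last by rewrite /mult (count_memPn kn).
  move: ts; rewrite typeBE // => /orP[/eqP ->|/and5P[_ _ _ _ /allP/(_ _ ks)]].
    by move: ok; case: k {ks} => [|[|[|[|k]]]].
  by rewrite (negPf ok).
rewrite /pi1; elim: (rev _) => //= k ks ->; rewrite cats0 (_ : _./2 = 0) //.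
by have := ne (2 * k); rewrite mul2n odd_double => /(_ isT); lia.
Qed.

End TypeB.

(** * The generating function of the St-crank *)

Section TotalGF.
Local Open Scope ring_scope.
Variables (A : comUnitRingType) (x y q : A) (M : nat).
Hypotheses (ux : x \is a GRing.unit) (uy : y \is a GRing.unit) (qM : q ^+ M = 0).
Hypothesis (M0 : (0 < M)%N).
Let L := (M + M)%N.
Let W := srank_wt (x * y) q.

Definition stcrank_gf : A := \sum_(s <- plist (fun=> 2 * L)%N (parts_upto (2 * L)))
  x ^ stcrank s * y ^ hsrank s * q ^+ psize s.

Lemma mem_norep_plist e : (psize e < M)%N ->
  (e \in plist (norep_even_bound L) (parts_upto (2 * L))) =
  [&& sorted geq e, 0%N \notin e & norep_even e].
Proof.
move=> he; rewrite mem_plist ?parts_upto_sorted //; congr (_ && _).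
apply/andP/andP => [] [h1 h2]; split.
- by apply/negP => /(allP h1) /=; rewrite mem_parts_upto.
- apply/allP => k ke; have := allP h2 k (allP h1 k ke); rewrite /norep_even_bound.
  by case: ifP.
- apply/allP => k ke /=; rewrite mem_parts_upto lt0n; apply/andP; split.
    by apply: contraNneq h1 => <-.
  by apply: leq_trans (leq_mem_sumn ke) _; rewrite -/(psize e) /L; lia.
apply/allP => k kL; rewrite /norep_even_bound; case: ifP => ok.
  apply: leq_ltn_trans (count_size _ _) _; apply: leq_ltn_trans (size_leq_sumn h1) _.
  by rewrite -/(psize e) /L; lia.
case: (boolP (k \in e)) => [ke|/count_memPn -> //].
by have := allP h2 k ke; rewrite ok.
Qed.

(** [typeB_grow] is a bijection that preserves the srank and adds 4 to the size. Sizes from M on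
    carry weight 0, and dropping them matches the two finite lists. *)
Lemma sum_typeB :
  \sum_(s <- plist (fun=> 2 * L)%N (parts_upto (2 * L)) | typeB s) W s =
  q ^+ 4 * srank_gf (x * y) q M L.
Proof.
have W0 s : (M <= psize s)%N -> W s = 0.
  by move=> h; rewrite /W /srank_wt (expr_nilp_ge qM h) mulr0.
rewrite (bigID (fun s => psize s < M)%N) /= [X in _ + X]big1 ?addr0; last first.
  by move=> s /andP[_]; rewrite -leqNgt => /W0.
rewrite /srank_gf mulr_sumr [RHS](bigID (fun e => psize e + 4 < M)%N) /= [X in _ + X]big1 ?addr0; last first.
  move=> e; rewrite -leqNgt => h.
  by rewrite /srank_wt mulrCA -exprD addnC (expr_nilp_ge qM h) mulr0.
transitivity (\sum_(e <- plist (norep_even_bound L) (parts_upto (2 * L)) | (psize e + 4 < M)%N) W (typeB_grow e));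
  last first.
  apply: eq_bigr => e _; rewrite /W /srank_wt hsrank_typeB_grow psize_typeB_grow exprD; ring.
rewrite -big_filter -[RHS]big_filter -(big_map typeB_grow xpredT W); apply: perm_big.
have us b : uniq (plist b (parts_upto (2 * L))) by apply/plist_uniq/parts_upto_sorted.
apply: uniq_perm; rewrite ?filter_uniq ?map_inj_uniq ?filter_uniq //; first exact: typeB_grow_inj.
move=> s; rewrite mem_filter; apply/idP/mapP.
  case/andP=> /andP[ts sM]; rewrite mem_plist_upto; [|by move=> _; rewrite /L; lia|by rewrite /L; lia].
  case/andP=> ss s0; have [e [se e0 ne es]] := typeB_grow_onto ss s0 ts.
  exists e => //; rewrite es psize_typeB_grow in sM.
  by rewrite mem_filter sM mem_norep_plist ?se ?e0 //; lia.
case=> e; rewrite mem_filter => /andP[eM]; rewrite mem_norep_plist; last by lia.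
case/and3P=> se e0 ne ->; have [ss s0 ts] := typeB_grow_valid se e0 ne.
rewrite ts psize_typeB_grow eM mem_plist_upto ?ss ?s0 // psize_typeB_grow.
- by move=> _; rewrite /L; lia.
- by rewrite /L; lia.
Qed.

Let Q := q ^+ 4.

(** x^Psi is 1 plus (x - 1) times the indicator of type B, and on type B [pi1] is empty with crank
    0. *)
Lemma stcrank_gf_split :
  stcrank_gf = (crank_gf x Q L + (x - 1) * Q) * srank_gf (x * y) q M L.
Proof.
have uxy : x * y \is a GRing.unit by rewrite unitrM ux.
rewrite mulrDl -mulrA -[Q]/(q ^+ 4) -sum_typeB.
have := @pi1_split A q L L (fun p => x ^ crank p) W (srank_wt_even_pair (x * y) q); rewrite -/(crank_gf x Q L) -/(srank_gf (x * y) q M L).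
move=> <-.
rewrite mulr_sumr [X in _ + X]big_mkcond -big_split /stcrank_gf !big_seq.
apply: eq_bigr => s; rewrite mem_plist ?parts_upto_sorted // => /and3P[ss sa _].
have s0 : 0%N \notin s by apply/negP => /(allP sa) /=; rewrite mem_parts_upto.
rewrite /stcrank half_srank // !exprzDr //= /W /srank_wt.
have -> : (x * y) ^ hsrank s = x ^ hsrank s * y ^ hsrank s by apply: exprMz_comm => //; apply: mulrC.
rewrite /Psi; case: ifP => ts; last by rewrite expr0z; ring.
by rewrite (pi1_typeB ss s0 ts) expr1z /= (_ : crank [::] = 0) // expr0z; ring.
Qed.

Lemma stcrank_gfE :
  stcrank_gf * (qpoch (x * Q) Q M * qpoch (x^-1 * Q) Q M *
    (qpoch (x * y * q ^+ 2) Q M * qpoch ((x * y)^-1 * q ^+ 2) Q M)) =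
  qpoch Q Q M * (qpoch (- q) Q M * qpoch (- q ^+ 3) Q M).
Proof.
have QM : Q ^+ M = 0 by rewrite /Q exprS; apply: exprM_nilp.
have QL : Q ^+ L = 0 by rewrite exprD QM mul0r.
have L1 : (1 < L)%N by rewrite /L; lia.
have uxy : x * y \is a GRing.unit by rewrite unitrM ux.
rewrite -(srank_gfE uxy qM) stcrank_gf_split.
have := crank_gfE ux QL L1; rewrite !(qpoch_stable _ QM (leq_addr M M)) -/Q -/L => <-.
by rewrite -!mulrA; congr (_ * _); rewrite mulrCA; congr (_ * _); rewrite mulrCA.
Qed.

End TotalGF.

(** * Fifth roots of unity and theta series *)

Section ThetaProduct.
Local Open Scope ring_scope.
Variable A : comUnitRingType.
Implicit Types a p w x : A.

Lemma qpoch_double a p n :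
  qpoch a p (n + n) = qpoch a (p ^+ 2) n * qpoch (a * p) (p ^+ 2) n.
Proof.
elim: n => [|n IH]; first by rewrite !qpoch0 mulr1.
rewrite addnS addSn !qpochS IH -!exprM (_ : (2 * n = n + n)%N); last by lia.
by rewrite [p ^+ (n + n).+1]exprS; ring.
Qed.

(** With s = x + x^4, conjugate roots pair into 1 - s w + w^2 and 1 + (1 + s) w + w^2, and s (1 + s)
    = 1. *)
Lemma prod5_roots x w : x ^+ 5 = 1 -> 1 + x + x ^+ 2 + x ^+ 3 + x ^+ 4 = 0 ->
  (1 - w) * (1 - x * w) * (1 - x ^+ 4 * w) * (1 - x ^+ 2 * w) * (1 - x ^+ 3 * w) = 1 - w ^+ 5.
Proof.
move=> x5 h; have e : x ^+ 4 = - (1 + x + x ^+ 2 + x ^+ 3).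
  by apply/eqP; rewrite -addr_eq0 addrC; apply/eqP.
have e5 : x * x ^+ 4 = 1 by rewrite -exprS.
have p1 : (1 - x * w) * (1 - x ^+ 4 * w) = 1 - (x + x ^+ 4) * w + w ^+ 2.
  rewrite (_ : _ * _ = 1 - (x + x ^+ 4) * w + (x * x ^+ 4) * w ^+ 2); last by ring.
  by rewrite e5 mul1r.
have p2 : (1 - x ^+ 2 * w) * (1 - x ^+ 3 * w) = 1 + (1 + x + x ^+ 4) * w + w ^+ 2.
  rewrite (_ : _ * _ = 1 - (x ^+ 2 + x ^+ 3) * w + x ^+ 5 * w ^+ 2); last by ring.
  by rewrite x5 mul1r e; ring.
have p3 : (x + x ^+ 4) * (1 + x + x ^+ 4) = 1.
  rewrite (_ : _ * _ = x + x ^+ 2 + x ^+ 4 + x ^+ 5 + x ^+ 5 + x ^+ 3 * x ^+ 5); last by ring.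
  rewrite x5 mulr1 (_ : _ + _ = (1 + x + x ^+ 2 + x ^+ 3 + x ^+ 4) + 1); last by ring.
  by rewrite h add0r.
rewrite -[LHS]mulrA p2 -(mulrA (1 - w)) p1.
rewrite (_ : _ * _ = (1 - w) * (1 + w + (2 - (x + x ^+ 4) * (1 + x + x ^+ 4)) * w ^+ 2 + w ^+ 3 + w ^+ 4)); last by ring.
by rewrite p3; ring.
Qed.

Lemma qpoch5_roots x p n : x ^+ 5 = 1 -> 1 + x + x ^+ 2 + x ^+ 3 + x ^+ 4 = 0 ->
  qpoch p p n * qpoch (x * p) p n * qpoch (x ^+ 4 * p) p n *
  qpoch (x ^+ 2 * p) p n * qpoch (x ^+ 3 * p) p n = qpoch (p ^+ 5) (p ^+ 5) n.
Proof.
move=> x5 h; elim: n => [|n IH]; first by rewrite !qpoch0 !mulr1.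
rewrite !qpochS -exprM -exprD -IH.
have := prod5_roots (p ^+ n.+1) x5 h.
rewrite -exprM (_ : (n.+1 * 5 = 5 + 5 * n)%N); last by lia.
by move=> <-; rewrite !exprS; ring.
Qed.

Variables (x y q : A) (M : nat).
Hypotheses (x5 : x ^+ 5 = 1) (sx : 1 + x + x ^+ 2 + x ^+ 3 + x ^+ 4 = 0).
Hypotheses (yy : y * y = 1) (qM : q ^+ M = 0) (M0 : (0 < M)%N).
Let L := (M + M)%N.
Let p := y * q ^+ 2.

(** As y^2 = 1 gives p^2 = q^4, the crank and srank denominators merge into (xp; p) (p/x; p). The
    triple product needs (x^2; p), whose first factor is the extra 1 - x^2. *)
Lemma stcrank_gf_theta m : (L + L < m)%N ->
  stcrank_gf x y q M * (1 - x ^+ 2) * qpoch (p ^+ 5) (p ^+ 5) L =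
  (\sum_(j < (m + m).+1) theta_term q (q ^+ 3) (j%:Z - m%:Z)) *
  (\sum_(j < (m + m).+1) theta_term (- x ^+ 2) (- (x ^+ 3 * p)) (j%:Z - m%:Z)).
Proof.
move=> Lm.
have xx4 : x * x ^+ 4 = 1 by rewrite -exprS.
have ux : x \is a GRing.unit by apply/unitrPr; exists (x ^+ 4).
have uy : y \is a GRing.unit by apply/unitrPr; exists y.
have xV : x^-1 = x ^+ 4 by apply: (mulrI ux); rewrite xx4 divrr.
have yV : y^-1 = y by apply: (mulrI uy); rewrite yy divrr.
have pM : p ^+ M = 0 by rewrite /p mulrC; apply: exprM_nilp; rewrite exprS; apply: exprM_nilp.
have p2 : p ^+ 2 = q ^+ 4 by rewrite /p exprMn -exprM expr2 yy mul1r.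
have QM : (q * q ^+ 3) ^+ M = 0 by apply: exprM_nilp.
have ab : - x ^+ 2 * - (x ^+ 3 * p) = p by rewrite mulrNN mulrA -exprD x5 mul1r.
rewrite -(jacobi_triple QM) ?(jacobi_triple (M := L)); last by rewrite /L in Lm; lia.
rewrite -(@jacobi_triple _ (- x ^+ 2) (- (x ^+ 3 * p)) L) ?ab //; last by rewrite exprD pM mulr0.
rewrite !opprK -exprS -[qpoch (q ^+ 4) _ _ * _ * _]mulrA -(stcrank_gfE ux uy qM M0) -/L.
have pL : p ^+ L = 0 by rewrite exprD pM mulr0.
have e1 z : qpoch (z * q ^+ 4) (q ^+ 4) M * qpoch (z * p) (q ^+ 4) M = qpoch (z * p) p L.
  by rewrite qpoch_double p2 mulrC -mulrA -expr2 p2.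
have e2 : qpoch (x ^+ 2) p L = (1 - x ^+ 2) * qpoch (x ^+ 2 * p) p L.
  by rewrite -(qpoch_stable _ pL (leqnSn L)) qpochSl.
rewrite e2 -(qpoch5_roots p L x5 sx) -!e1 xV invrM // yV xV.
rewrite -[x * y * _]mulrA [y * x ^+ 4]mulrC -[x ^+ 4 * y * _]mulrA -/p.
ring.
Qed.

End ThetaProduct.

(** * Exponents modulo 5 and cancellation *)

Section Residues.
Local Open Scope ring_scope.

Lemma triD1 (r : int) : (tri (r + 1))%:Z = (tri r)%:Z + r.
Proof.
have [r0|r0] := lerP 0 r.
  by have := @triS r `|r|%N 0%N; lia.
by have := @triS r 0%N `|r|%N; lia.
Qed.

Lemma tri2 (r : int) : (tri r)%:Z * 2 = r * (r - 1).
Proof.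
elim: r => [//|n IH|n IH].
  have -> : n.+1%:Z = n%:Z + 1 by lia.
  by rewrite triD1 mulrDl IH; ring.
have := triD1 (- n.+1%:Z); have -> : - n.+1%:Z + 1 = - n%:Z by lia.
move=> e; have {e} -> : (tri (- n.+1%:Z))%:Z = (tri (- n%:Z))%:Z + n.+1%:Z by lia.
rewrite mulrDl IH; have -> : n.+1%:Z = n%:Z + 1 by lia.
ring.
Qed.

Lemma tri_1B (r : int) : tri (1 - r) = tri r.
Proof.
have h1 := tri2 r; have h2 := tri2 (1 - r).
have : (1 - r) * (1 - r - 1) = r * (r - 1) by ring.
by rewrite -h1 -h2; lia.
Qed.

(** Here c = i (i - 1) for r = 5 z + i; the relations are linear in z and w, so that residues can be
    combined by linear arithmetic. *)
Lemma tri_mod5 (r : int) : exists z w c : int, (tri r)%:Z * 2 = 5 * w + c /\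
  [\/ r = 5 * z /\ c = 0, r = 5 * z + 1 /\ c = 0, r = 5 * z + 2 /\ c = 2 |
      r = 5 * z + 3 /\ c = 6 \/ r = 5 * z + 4 /\ c = 12].
Proof.
have h := tri2 r; have := divz_eq r 5; set z := (r %/ 5)%Z => e.
have : (0 <= r %% 5)%Z && (r %% 5 < 5)%Z by rewrite modz_ge0 // ltz_pmod.
move: e; set i := (r %% 5)%Z => e i5.
exists z, (5 * z * z + z * (2 * i - 1)), (i * (i - 1)); split.
  by rewrite h e; ring.
have : [\/ i = 0, i = 1, i = 2 | i = 3 \/ i = 4].
  have [->|n0] := eqVneq i 0; first by apply: Or41.
  have [->|n1] := eqVneq i 1; first by apply: Or42.
  have [->|n2] := eqVneq i 2; first by apply: Or43.
  by apply: Or44; lia.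
by case=> [hi|hi|hi|[hi|hi]]; rewrite !hi; [apply: Or41|apply: Or42|apply: Or43
  |apply: Or44; left|apply: Or44; right]; lia.
Qed.

(* The exponent is 2 k^2 - k + r^2 - r; completing squares mod 5, -2 is not a square. *)
Lemma theta_exponent_mod5 (k r : int) :
  ((tri (k + 1) + 3 * tri k + 2 * tri r) %% 5 = 4)%N -> (5 %| 2 * r - 1)%Z.
Proof.
have := triD1 k; have [z [w [c [h hc]]]] := tri_mod5 k; have [z' [w' [c' [h' hc']]]] := tri_mod5 r.
by move=> e e4; case: hc => [[ek ec]|[ek ec]|[ek ec]|[[ek ec]|[ek ec]]];
  case: hc' => [[er ec']|[er ec']|[er ec']|[[er ec']|[er ec']]]; lia.
Qed.

(** The two exponents differ by 2 r - 1, an odd multiple of 5, and (-x)^5 = -1. *)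
Lemma expr_tri_neg (F : fieldType) (x : F) (r : int) : x ^+ 5 = 1 -> (5 %| 2 * r - 1)%Z ->
  (- x) ^+ tri (r + 1) + (- x) ^+ tri (r - 1) = 0.
Proof.
move=> x5 r5; have sgn n : (5 %| n)%N -> odd n -> (- x) ^+ n = -1.
  move=> /dvdnP[j ->]; rewrite oddM andbT => oj.
  by rewrite exprNn -signr_odd oddM andbT oj mulnC exprM x5 expr1n mulr1.
have e : (tri (r + 1))%:Z = (tri (r - 1))%:Z + (2 * r - 1).
  by have := triD1 r; have := triD1 (r - 1); rewrite subrK; lia.
have odd_n : odd (absz (2 * r - 1)%R) by lia.
have n5 : (5 %| absz (2 * r - 1)%R)%N by [].
move: e n5 odd_n; have [r0|r0] := lerP 0 (2 * r - 1); set n := absz (2 * r - 1)%R => e n5 odd_n.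
  have -> : tri (r + 1) = (tri (r - 1) + n)%N by lia.
  by rewrite exprD (sgn n) // mulrN1 addNr.
have -> : tri (r - 1) = (tri (r + 1) + n)%N by lia.
by rewrite exprD (sgn n) // mulrN1 subrr.
Qed.

Variables (F : fieldType) (A : comUnitAlgType F) (q : A).

(* Finite sums of monomials c q^e with e not 4 mod 5. *)
Inductive avoids4 : A -> Prop :=
| Avoids0 : avoids4 0
| AvoidsD c e a : (e %% 5 != 4)%N -> avoids4 a -> avoids4 (c *: q ^+ e + a).

Lemma avoids4D a b : avoids4 a -> avoids4 b -> avoids4 (a + b).
Proof. by move=> ha hb; elim: ha => [|c e a' he _ IH]; rewrite ?add0r // -addrA; apply: AvoidsD. Qed.

Lemma avoids4Z c a : avoids4 a -> avoids4 (c *: a).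
Proof.
elim=> [|d e a' he _ IH]; first by rewrite scaler0; apply: Avoids0.
by rewrite scalerDr scalerA; apply: AvoidsD.
Qed.

Lemma avoids4_monomial c e : ((e %% 5)%N = 4%N -> c = 0) -> avoids4 (c *: q ^+ e).
Proof.
move=> h; have [/h ->|he] := eqVneq (e %% 5)%N 4; first by rewrite scale0r; apply: Avoids0.
by rewrite -[X in avoids4 X]addr0; apply: AvoidsD => //; apply: Avoids0.
Qed.

Lemma avoids4_sum (I : Type) (r : seq I) (f : I -> A) :
  (forall i, avoids4 (f i)) -> avoids4 (\sum_(i <- r) f i).
Proof.
move=> h; elim: r => [|i r IH]; first by rewrite big_nil; apply: Avoids0.
by rewrite big_cons; apply: avoids4D.
Qed.

Lemma avoids4_mulX5 c e a : (5 %| e)%N -> avoids4 a -> avoids4 (c *: q ^+ e * a).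
Proof.
move=> e5; elim=> [|d f a' hf _ IH]; first by rewrite mulr0; apply: Avoids0.
rewrite mulrDr -scalerAl -scalerAr scalerA -exprD; apply: AvoidsD => //.
by move: hf; rewrite -modnDm (eqP e5) add0n modn_mod.
Qed.

(** The inverse of 1 - c q^e is a finite sum of powers of c q^e, and multiplying by these keeps
    exponents mod 5. *)
Lemma avoids4_cancel c e a M : (c *: q ^+ e) ^+ M = 0 -> (5 %| e)%N ->
  avoids4 ((1 - c *: q ^+ e) * a) -> avoids4 a.
Proof.
move=> wM e5; set b := _ * a => hb.
have -> : a = \sum_(m < M) (c *: q ^+ e) ^+ m * b.
  by rewrite -mulr_suml mulrA geometric_nilp // mul1r.
apply: avoids4_sum => m; rewrite exprZn -exprM; apply: avoids4_mulX5 => //.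
exact: dvdn_mulr.
Qed.

Lemma avoids4_qpoch c e M n a : (c *: q ^+ e) ^+ M = 0 -> (5 %| e)%N ->
  avoids4 (a * qpoch (c *: q ^+ e) (c *: q ^+ e) n) -> avoids4 a.
Proof.
move=> wM e5; elim: n => [|n IH]; first by rewrite qpoch0 mulr1.
rewrite qpochS mulrA mulrC -exprS => h; apply: IH.
move: h; rewrite exprZn -exprM; apply: (@avoids4_cancel _ _ _ M); last exact: dvdn_mulr.
rewrite (_ : _ *: _ = (c *: q ^+ e) ^+ n.+1); last by rewrite exprZn exprM.
by rewrite exprAC wM expr0n.
Qed.

Variables (x y : F) (M : nat).
Hypotheses (x1 : x != 1) (x5 : x ^+ 5 = 1) (yy : y * y = 1) (F2 : 2%:R != 0 :> F).
Hypotheses (qM : q ^+ M = 0) (M0 : (0 < M)%N).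

Lemma sum_pow5 : 1 + x + x ^+ 2 + x ^+ 3 + x ^+ 4 = 0.
Proof.
have : (x - 1) * (1 + x + x ^+ 2 + x ^+ 3 + x ^+ 4) = 0.
  by rewrite (_ : _ * _ = x ^+ 5 - 1); [rewrite x5 subrr|ring].
by move/eqP; rewrite mulf_eq0 subr_eq0 (negPf x1) => /eqP.
Qed.

Lemma avoids4_stcrank_gf : avoids4 (stcrank_gf x%:A y%:A q M).
Proof.
(* The least m allowed by [stcrank_gf_theta], which asks for m > 2 L with L = 2 M. *)
pose m := (M + M + (M + M)).+1.
have AX5 : (x%:A : A) ^+ 5 = 1 by rewrite exprZn expr1n x5 scale1r.
have AS : 1 + x%:A + x%:A ^+ 2 + x%:A ^+ 3 + x%:A ^+ 4 = 0 :> A.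
  by rewrite !exprZn !expr1n -{1}[1]scale1r -!scalerDl sum_pow5 scale0r.
have AY : y%:A * y%:A = 1 :> A by rewrite -scalerAl mul1r scalerA yy scale1r.
have := stcrank_gf_theta AX5 AS AY qM M0 (ltnSn _ : (_ < m)%N).
set G := stcrank_gf _ _ _ _ => e.
have pE : (y%:A * q ^+ 2) ^+ 5 = y ^+ 5 *: q ^+ 10 by rewrite -scalerAl mul1r exprZn -exprM.
have wM : (y ^+ 5 *: q ^+ 10) ^+ M = 0 by rewrite exprZn [(q ^+ 10) ^+ M]exprAC qM expr0n scaler0.
(* The extra factors can be divided out: the product involves only powers of q^10, and 1 - x^2 is a
   nonzero scalar, since x^2 = 1 and x^5 = 1 would give x = 1. *)
suff h : avoids4 (G * (1 - x%:A ^+ 2) * qpoch ((y%:A * q ^+ 2) ^+ 5) ((y%:A * q ^+ 2) ^+ 5) (M + M)).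
  move: h; rewrite pE => /(avoids4_qpoch wM (isT : (5 %| 10)%N)).
  have -> : G * (1 - x%:A ^+ 2) = (1 - x ^+ 2) *: G.
    by rewrite exprZn expr1n -{1}[1]scale1r -scalerBl -scalerAr mulr1.
  move/(avoids4Z (1 - x ^+ 2)^-1); rewrite scalerA mulVf ?scale1r //.
  apply: contra_neq x1 => /eqP; rewrite subr_eq0 => /eqP x2.
  by rewrite -x5 -[RHS]mul1r (_ : 5 = (2 * 2).+1)%N // exprS exprM -x2 expr1n mulr1 mul1r.
rewrite e {e}; set S1 := \sum_(j < _) _; set th := theta_term (- x%:A ^+ 2) _.
pose c r := (- x ^+ 2) ^+ tri (r + 1) * (- (x ^+ 3 * y)) ^+ tri r.
have thE r : th r = c r *: q ^+ (2 * tri r).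
  rewrite /th /theta_term -!scalerAl !mul1r !exprZn !expr1n -!scalerAl mul1r scalerA -!scaleNr.
  by rewrite !exprZn expr1n -scalerAl mul1r scalerA -exprM.
have th0 r : ((M + M).+1 < `|r|)%N -> th r = 0.
  move=> hr; apply: theta_term_nilp hr; rewrite mulrNN [_ ^+ 2 * (_ * _)]mulrA -exprD AX5 mul1r.
  by rewrite -scalerAl mul1r exprZn -[(q ^+ 2) ^+ _]exprM (expr_nilp_ge qM) ?scaler0 //; lia.
set S2 := \sum_(j < (m + m).+1) th _.
(* The two ranges of summation differ by vanishing terms only. *)
have S2r : S2 = \sum_(j < (m + m).+1) th (1 - (j%:Z - m%:Z)).
  rewrite [RHS](reindex_inj rev_ord_inj) /=.
  transitivity (\sum_(j < (m + m).+1) th (j.+1%:Z - m%:Z)); last first.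
    by apply: eq_bigr => j _; congr th; have := ltn_ord j; lia.
  rewrite /S2 big_ord_recl [RHS]big_ord_recr /= !th0 ?add0r ?addr0; [|lia|lia].
  by apply: eq_bigr => j _; congr th; rewrite /bump; lia.
(* Averaging over the reflection r -> 1 - r pairs the terms that will cancel. *)
have -> : S1 * S2 = 2%:R^-1 *: (\sum_(j < (m + m).+1) (\sum_(k < (m + m).+1)
   theta_term q (q ^+ 3) (k%:Z - m%:Z) * (th (j%:Z - m%:Z) + th (1 - (j%:Z - m%:Z))))).
  under eq_bigr => j _ do rewrite -mulr_suml -/S1.
  rewrite -mulr_sumr big_split /= -S2r -/S2 -mulr2n -[S2 *+ 2]scaler_nat -scalerAr scalerA mulVf //.
  by rewrite scale1r.
apply: avoids4Z; apply: avoids4_sum => j; apply: avoids4_sum => k.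
set r := j%:Z - m%:Z; set t := k%:Z - m%:Z.
have -> : theta_term q (q ^+ 3) t * (th r + th (1 - r)) =
    (c r + c (1 - r)) *: q ^+ (tri (t + 1) + 3 * tri t + 2 * tri r).
  by rewrite !thE tri_1B -scalerDl -scalerAr /theta_term -exprM -!exprD.
apply: avoids4_monomial => /theta_exponent_mod5 r5.
(* The power with exponent [tri r] is common to both terms; the other exponents are [tri (r + 1)]
   and [tri (r - 1)], and [expr_tri_neg] applies to x^2. *)
rewrite /c tri_1B -mulrDl (_ : 1 - r + 1 = 1 - (r - 1)); last by ring.
rewrite tri_1B expr_tri_neg ?mul0r //.
by rewrite exprAC x5 expr1n.
Qed.

End Residues.

(** * Coefficient extraction and Fourier inversion *)

Section TruncatedSeries.
Local Open Scope ring_scope.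
Variables (F : fieldType) (N : nat).

(** Power series modulo X^(N+1): q is nilpotent, yet the coefficient of q^N can still be read
    off. *)
Definition series_trunc := {poly %/ 'X^(N.+1) : {poly F}}.

Lemma coef_qXn e i : (i <= N)%N ->
  (('qX ^+ e : series_trunc) : {poly F})`_i = (i == e)%:R.
Proof.
move=> iN; rewrite -[_ ^+ e](rmorphXn (in_qpoly _)) /= mk_monic_Xn /= -Pdiv.RingMonic.take_poly_rmodp.
by rewrite coef_take_poly ltnS iN coefXn.
Qed.

Lemma qX_nilp : ('qX : series_trunc) ^+ N.+1 = 0.
Proof.
apply/val_inj/polyP => i; rewrite coef0.
have [iN|Ni] := leqP i N; first by rewrite coef_qXn // ltn_eqF.
by rewrite nth_default // (leq_trans (size_npoly _)) // mk_monic_Xn size_polyXn.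
Qed.

Lemma coef_avoids4 (a : series_trunc) : (N %% 5 = 4)%N -> avoids4 'qX a ->
  (a : {poly F})`_N = 0.
Proof.
move=> N4; elim=> [|c e b e4 _ IH]; first by rewrite coef0.
rewrite coefD coefZ IH coef_qXn // addr0; case: eqP => [Ne|]; last by rewrite mulr0.
by rewrite -Ne N4 in e4.
Qed.

Lemma coef_stcrank_gf (x y : F) : x != 0 -> y != 0 ->
  (stcrank_gf (x%:A : series_trunc) y%:A 'qX N.+1 : {poly F})`_N =
  \sum_(s <- plist (fun=> 2 * (N.+1 + N.+1))%N (parts_upto (2 * (N.+1 + N.+1))) | psize s == N)
    x ^ stcrank s * y ^ hsrank s.
Proof.
move=> x0 y0; rewrite /stcrank_gf poly_of_qpoly_sum coef_sum [RHS]big_mkcond.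
apply: eq_bigr => s _.
have cE (z : F) m : z != 0 -> (z%:A : series_trunc) ^ m = (z ^ m)%:A.
  by move=> z0; rewrite -!/(in_alg series_trunc _) rmorphXz // unitfE.
rewrite !cE // -scalerAl mul1r scalerA -scalerAl mul1r coefZ coef_qXn // eq_sym.
by case: eqP => _; rewrite ?mulr1 ?mulr0.
Qed.

Lemma sum_stcrank_eq0 (x y : F) : x != 1 -> x ^+ 5 = 1 -> y * y = 1 -> 2%:R != 0 :> F ->
  (N %% 5 = 4)%N ->
  \sum_(s <- plist (fun=> 2 * (N.+1 + N.+1))%N (parts_upto (2 * (N.+1 + N.+1))) | psize s == N)
    x ^ stcrank s * y ^ hsrank s = 0.
Proof.
move=> x1 x5 yy F2 N4; rewrite -coef_stcrank_gf.
- by apply: coef_avoids4 => //; apply: avoids4_stcrank_gf => //; apply: qX_nilp.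
- by apply: contra_eq_neq x5 => ->; rewrite expr0n eq_sym oner_eq0.
by apply: contra_eq_neq yy => ->; rewrite mul0r eq_sym oner_eq0.
Qed.

End TruncatedSeries.

Section Fourier.
Local Open Scope ring_scope.

Lemma natr_count (R : pzSemiRingType) (T : Type) (P : pred T) (s : seq T) :
  (count P s)%:R = \sum_(t <- s) (P t)%:R :> R.
Proof. by rewrite -sum1_count natr_sum big_mkcond; apply: eq_bigr => t _; case: (P t). Qed.

Lemma sum_prim_root5 (F : fieldType) (z : F) (e : int) : 5.-primitive_root z ->
  \sum_(j < 5) (z ^+ j) ^ e = if (5 %| e)%Z then 5%:R else 0.
Proof.
move=> pz; have z5 := prim_expr_order pz.
have z0 : z != 0 by apply: contra_eq_neq z5 => ->; rewrite expr0n eq_sym oner_eq0.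
have -> : \sum_(j < 5) (z ^+ j) ^ e = \sum_(j < 5) (z ^ e) ^+ j.
  by apply: eq_bigr => j _; rewrite !exprnP exprzAC.
case: ifP => e5.
  have -> : z ^ e = 1 by case/dvdzP: e5 => m ->; rewrite mulrC -exprz_exp -exprnP z5 exp1rz.
  by under eq_bigr => j _ do rewrite expr1n; rewrite sumr_const card_ord.
have ze : z ^ e != 1.
  have er : e = 5%:Z * (e %/ 5)%Z + `|(e %% 5)%Z|%N%:Z.
    by rewrite {1}(divz_eq e 5) mulrC; congr (_ + _); lia.
  rewrite er expfzDr // -exprz_exp -exprnP z5 exp1rz mul1r -exprnP -(expr0 z) (eq_prim_root_expr pz).
  by apply/negP => /eqP; lia.
have : (z ^ e - 1) * (\sum_(j < 5) (z ^ e) ^+ j) = 0.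
  by rewrite -subrX1 exprnP exprzAC -exprnP z5 exp1rz subrr.
by move/eqP; rewrite mulf_eq0 subr_eq0 (negPf ze) => /eqP.
Qed.

(** The srank is 2 h, so its class mod 4 is the parity of h, which the characters 1 and (-1)^h
    detect. *)
Lemma srank_mod4_indicator (F : fieldType) (i h : int) : 2%:R != 0 :> F ->
  (i == 0) || (i == 2) ->
  (((h *+ 2) %% 4)%Z == i)%:R = 2%:R^-1 * (1 ^ h + (if i == 0 then 1 else -1) * (-1) ^ h) :> F.
Proof.
move=> F2 hi; have N0 : -1 != 0 :> F by rewrite oppr_eq0 oner_eq0.
have e2 m : (-1) ^ (2%:Z * m) = 1 :> F by rewrite -exprz_exp -exprnP sqrrN expr1n exp1rz.
have [m [hm|hm]] : exists m, h = 2%:Z * m \/ h = 2%:Z * m + 1.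
  by exists (h %/ 2)%Z; lia.
- rewrite exp1rz hm e2 mulr1; case/orP: hi => /eqP ->; rewrite /=.
  + have -> : ((2%:Z * m *+ 2) %% 4)%Z == 0 by lia.
    by rewrite mulVf.
  + have -> : (((2%:Z * m *+ 2) %% 4)%Z == 2) = false by lia.
    by rewrite subrr mulr0.
rewrite exp1rz hm expfzDr // e2 expr1z mul1r; case/orP: hi => /eqP ->; rewrite /=.
+ have -> : ((((2%:Z * m + 1) *+ 2) %% 4)%Z == 0) = false by lia.
  by rewrite mul1r subrr mulr0.
have -> : (((2%:Z * m + 1) *+ 2) %% 4)%Z == 2 by lia.
by rewrite mulrNN mulr1 mulVf.
Qed.

End Fourier.

Theorem theorem1 (n : nat) (i : int) (k : int) :
  (i == 0%Z) || (i == 2%Z) -> (0 <= k)%R -> (k <= 4)%R ->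
  5 * npart (5 * n + 4)
        (fun s => ((srank s %% 4)%Z == i) && ((stcrank s %% 5)%Z == k))
  = p_i i (5 * n + 4).
Proof.
move=> hi k0 k4; set N := 5 * n + 4; have N4 : N %% 5 = 4 by rewrite /N; lia.
pose L := 2 * (N.+1 + N.+1); set l := plist (fun=> L) (parts_upto L).
have npE P : npart N P = count (fun s => (psize s == N) && P s) l.
  by apply: npartE => [_|]; rewrite /L; lia.
(* The equality moves to [algC], which has characteristic 0 and contains the fifth roots of
   unity. *)
rewrite /p_i !npE; apply/eqP; rewrite -(eqr_nat algC) natrM !natr_count; apply/eqP.
have F2 : (2%:R != 0 :> algC)%R by rewrite pnatr_eq0.
have [z pz] := C_prim_root_exists (isT : 0 < 5).
have z5 := prim_expr_order pz.
have z0 : (z != 0)%R by apply: contra_eq_neq z5 => ->; rewrite expr0n eq_sym oner_eq0.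
pose e : algC := (if i == 0%Z then 1 else -1)%R.
have srt s : s \in l -> sorted geq s by rewrite mem_plist ?parts_upto_sorted // => /and3P[].
pose T (x y : algC) := (\sum_(s <- l | psize s == N) x ^ stcrank s * y ^ hsrank s)%R.
(* For j < 4 the z^(j+1) are the nontrivial fifth roots of unity, where the coefficient of q^N
   vanishes. *)
have T0 j : (T (z ^+ j.+1) 1 = 0 /\ T (z ^+ j.+1) (-1) = 0)%R \/ ~~ (j < 4).
  case: (ltnP j 4) => j4; last by right.
  have zj1 : (z ^+ j.+1 != 1)%R.
    by rewrite -(expr0 z) (eq_prim_root_expr pz); apply/negP => /eqP; lia.
  have zj5 : ((z ^+ j.+1) ^+ 5 = 1)%R by rewrite exprAC z5 expr1n.
  by left; split; apply: sum_stcrank_eq0; rewrite ?mulrNN ?mulr1.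
(* Five times the indicator of residue k is the sum over j of z^(j (stcrank - k)). *)
transitivity (\sum_(j < 5) (z ^+ j) ^ (- k) * (2%:R^-1 * (T (z ^+ j) 1 + e * T (z ^+ j) (-1))))%R.
  rewrite mulr_sumr.
  under [RHS]eq_bigr => j _ do
    rewrite /T [(e * _)%R]mulr_sumr -big_split /= [(2%:R^-1 * _)%R]mulr_sumr mulr_sumr big_mkcond.
  rewrite exchange_big /= !big_seq; apply: eq_bigr => s /srt ss.
  case: eqP => _; last by rewrite mulr0 big1.
  rewrite andTb srankE // -mulnb natrM (srank_mod4_indicator _ F2 hi) -/e.
  transitivity ((2%:R^-1 * (1 ^ hsrank s + e * (-1) ^ hsrank s)) * \sum_(j < 5) (z ^+ j) ^ (stcrank s - k))%R.
    rewrite (sum_prim_root5 _ pz).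
    have -> : ((stcrank s %% 5)%Z == k) = (5 %| (stcrank s - k)%R)%Z by lia.
    by case: ifP => _; rewrite ?mulr1 ?mulr0 // mulrC.
  rewrite mulr_sumr; apply: eq_bigr => j _; rewrite expfzDr ?expf_neq0 //.
  ring.
(* Only j = 0 survives, where x = 1 and the srank indicator alone remains. *)
rewrite big_ord_recl [X in (_ + X)%R]big1 ?addr0 => [|j _]; last first.
  by case: (T0 j) => [[t1 t2]|]; [rewrite lift0 t1 t2 mulr0 addr0 !mulr0|rewrite ltn_ord].
rewrite expr0 exp1rz mul1r /T mulr_sumr -big_split mulr_sumr /= big_mkcond !big_seq.
apply: eq_bigr => s /srt ss; case: eqP => _ //.
by rewrite andTb srankE // (srank_mod4_indicator _ F2 hi) -/e !exp1rz !mul1r.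
Qed.
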